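(* For $p\ge0$, $u\ge0$, $\mu>0$ let $$\psi_{p,u,\mu}(t):=\frac{1}{\mu(p+t)^{\mu}}-S_{\mu}(\sqrt t,u)\quad(t>0),\qquad \varphi_u(x):=x\sum_{k=1}^{\infty}2(k+u)e^{-(k+u)^2x}\quad(x>0).$$ Then for each fixed $u\ge0$ and every $p\ge 0$ (in (1) and (2)): (1) The following are equivalent: $\psi_{p,u,\mu}\in M(0,+\infty)$ for every $\mu>0$; $\psi_{p,u,\mu}\in M(0,+\infty)$ for some $\mu>0$; $0\le p\le m_\infty(u)$. (2) The following are equivalent: $-\psi_{p,u,\mu}\in M(0,+\infty)$ for every $\mu>0$; $-\psi_{p,u,\mu}\in M(0,+\infty)$ for some $\mu>0$; $p\ge M_\infty(u)$. (3) $m_\infty(u)=-\sup_{x>0}\frac{\ln\varphi_u(x)}{x}$ and $M_\infty(u)=-\inf_{x>0}\frac{\ln\varphi_u(x)}{x}$. (4) $u^2+u<m_\infty(u)\le u^2+u+\frac16$ and $M_\infty(u)=(1+u)^2$.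
   Context: For $\mu>0$, $t\in\mathbb{R}$, $u\ge0$: $S_{\mu}(t,u):=\sum_{k=1}^{\infty}\frac{2(k+u)}{((k+u)^2+t^2)^{\mu+1}}$. Put $f_{\mu,u}(t)=(\mu S_\mu(t,u))^{-1/\mu}-t^2$, $m_\mu(u)=\inf_{t\ge0}f_{\mu,u}(t)$, $M_\mu(u)=\sup_{t\ge0}f_{\mu,u}(t)$, and $$m_\infty(u):=\inf_{\mu>0}m_\mu(u)=\lim_{\mu\to+\infty}m_\mu(u),\qquad M_\infty(u):=\sup_{\mu>0}M_\mu(u)=\lim_{\mu\to+\infty}M_\mu(u)$$ ($m_\mu(u)$ is non-increasing and $M_\mu(u)$ is non-decreasing in $\mu$). $M(0,+\infty)$ is the class of completely monotonic functions: $f\in C^\infty(0,+\infty)$ with $(-1)^kf^{(k)}(t)\ge0$ for all $k\in\mathbb{Z}_+=\{0,1,2,\dots\}$ and $t>0$. *)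

(* Defs.v *)
From Stdlib Require Import Reals.
From Coquelicot Require Import Coquelicot.
Open Scope R_scope.

(** The Coquelicot series start at index 0: the summation index of the
    mathematical series is [INR (k + 1)]. *)
Definition S_mu (mu t u : R) : R :=
  Series (fun k : nat =>
    2 * (INR (k + 1) + u)
      / Rpower ((INR (k + 1) + u) ^ 2 + t ^ 2) (mu + 1)).

Definition f_mu (mu u t : R) : R :=
  Rpower (mu * S_mu mu t u) (- (1 / mu)) - t ^ 2.

(** Infima and suprema are taken in the extended reals, so that finiteness is
    never presupposed. *)
Definition m_mu (mu u : R) : Rbar :=
  Glb_Rbar (fun y : R => exists t : R, 0 <= t /\ y = f_mu mu u t).

Definition M_mu (mu u : R) : Rbar :=
  Lub_Rbar (fun y : R => exists t : R, 0 <= t /\ y = f_mu mu u t).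

Definition m_infty_u (u : R) : Rbar :=
  Rbar_glb (fun y : Rbar => exists mu : R, 0 < mu /\ y = m_mu mu u).

Definition M_infty_u (u : R) : Rbar :=
  Rbar_lub (fun y : Rbar => exists mu : R, 0 < mu /\ y = M_mu mu u).

(** Only the values of [f] on (0, +oo) matter, since the derivatives are taken
    at interior points. *)
Definition completely_monotonic (f : R -> R) : Prop :=
  forall (k : nat) (t : R), 0 < t ->
    ex_derive_n f k t /\ 0 <= (-1) ^ k * Derive_n f k t.

Definition psi (p u mu t : R) : R :=
  1 / (mu * Rpower (p + t) mu) - S_mu mu (sqrt t) u.

Definition phi (u x : R) : R :=
  x * Series (fun k : nat =>
        2 * (INR (k + 1) + u) * exp (- (INR (k + 1) + u) ^ 2 * x)).

(* Main.v *)
Require Import Defs.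
From Stdlib Require Import Reals Lra Lia.
From Coquelicot Require Import Coquelicot.
Open Scope R_scope.

(** Write a_k = k + u for the nodes, q = u^2 + u = a_1 (a_1 - 1), and K_nu(T)
    for [S_mu nu (sqrt T) u], so that [psi] is 1 / (nu (p + T)^nu) - K_nu(T).

    Everything rests on reading the sums 2 a_k G(a_k^2), with G convex, as
    quadratures of the integral of G.  The intervals [a_k^2 - a_k, a_k^2 + a_k]
    have midpoint a_k^2 and length 2 a_k, and they tile [q, +oo), since
    a_k^2 + a_k = a_{k+1}^2 - a_{k+1}; the midpoint inequality therefore bounds
    the sum above by the integral of G from q.  The weight
    2 a_k = (a_k - 1/2) + (a_k + 1/2) splits into the half lengths of the two
    intervals between consecutive squares which meet at a_k^2; the trapezoid
    inequality therefore bounds the sum below by the integral of G from a_1^2.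
    With G(z) = x exp(- z x) this gives
    exp(- (1 + u)^2 x) <= phi(x) <= exp(- q x), and with
    G(z) = (z + T)^(- nu - 1) it gives 1 / (nu ((1 + u)^2 + T)^nu) <= K_nu(T).

    Differentiation shifts the index, psi_nu' = - (nu + 1) psi_{nu+1}, so
    [psi p u mu] is completely monotonic iff psi_{mu+k} >= 0 for all k, and the
    same holds with both signs reversed.  Moreover psi_{p,u,mu} >= 0 on
    (0, +oo) amounts to p <= f_mu.

    For (1), all conditions are equivalent to phi(x) <= exp(- p x) for every
    x > 0, that is, to p <= - sup ln(phi(x)) / x.  If psi_nu >= 0 along an
    arithmetic progression of indices nu, put T = nu / x and let nu tend to
    infinity, as in the Post-Widder inversion formula
    ([phi_le_of_psi_nonneg]).  Conversely, integrating the inequality against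
    x^(nu-1) exp(- T x), that is, using Euler's integral for the Gamma
    function, gives psi_nu >= 0 ([power_sum_le_of_phi_le]).

    Testing this on all the f_mu identifies m with - sup ln(phi(x)) / x.

    For (2), p >= (1 + u)^2 is sufficient by the trapezoid bound, and necessary
    because K_nu decays like (a_1^2 + T)^(- nu) as nu tends to infinity; hence
    M = (1 + u)^2.  The same two arguments for phi, which decays like
    x exp(- (1 + u)^2 x) as x tends to infinity, give
    inf ln(phi(x)) / x = - (1 + u)^2.

    For (4), the bound m <= q + 1/6 follows from a second order expansion of K_1
    at T = +oo, obtained by comparison with an explicit telescoping series
    ([power_sum_1_ge]).  The strict bound m > q quantifies the loss in the
    midpoint inequality: for small x the loss at all nodes together is of
    order x ([phi_excess]), and for larger x the loss at the first node
    suffices ([phi_first_term]). *)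

(** * Elementary estimates and telescoping series *)

Lemma nondecreasing_of_derive (f df : R -> R) (a b : R) :
  a <= b ->
  (forall x, a <= x <= b -> is_derive f x (df x)) ->
  (forall x, a <= x <= b -> 0 <= df x) ->
  f a <= f b.
Proof.
  intros Hab Hd Hp.
  destruct (MVT_gen f a b df) as [c [Hc E]].
  - intros x Hx. rewrite Rmin_left, Rmax_right in Hx by lra. apply Hd; lra.
  - intros x Hx. rewrite Rmin_left, Rmax_right in Hx by lra.
    apply continuity_pt_filterlim, (ex_derive_continuous f x).
    exists (df x). apply Hd; lra.
  - rewrite Rmin_left, Rmax_right in Hc by lra.
    assert (0 <= df c * (b - a)).
    { apply Rmult_le_pos; [apply Hp |]; lra. }
    lra.
Qed.

Lemma exp_le_exp (x y : R) : x <= y -> exp x <= exp y.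
Proof.
  intros [H | ->]; [apply Rlt_le, exp_increasing, H | apply Rle_refl].
Qed.

Lemma Series_le_of_partial_sums (x : nat -> R) (B : R) :
  ex_series x -> (forall n, sum_n x n <= B) -> Series x <= B.
Proof.
  intros Hx HB.
  apply (is_lim_seq_le (sum_n x) (fun _ => B) (Series x) B HB).
  - apply Series_correct, Hx.
  - apply is_lim_seq_const.
Qed.

Lemma sum_n_le_Series (x : nat -> R) (n : nat) :
  ex_series x -> (forall k, 0 <= x k) -> sum_n x n <= Series x.
Proof.
  intros Hx H0.
  apply (is_lim_seq_incr_compare (sum_n x) (Series x)).
  - apply Series_correct, Hx.
  - intros k. rewrite sum_Sn. unfold plus; simpl. generalize (H0 (S k)); lra.
Qed.

Lemma sum_n_le_telescope (x V : nat -> R) (n : nat) :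
  (forall k, x k <= V k - V (S k)) -> sum_n x n <= V 0%nat - V (S n).
Proof.
  intros H; induction n as [|n IH].
  - rewrite sum_O. apply H.
  - rewrite sum_Sn. unfold plus; simpl. generalize (H (S n)); lra.
Qed.

Lemma telescope_le_sum_n (x V : nat -> R) (n : nat) :
  (forall k, V k - V (S k) <= x k) -> V 0%nat - V (S n) <= sum_n x n.
Proof.
  intros H; induction n as [|n IH].
  - rewrite sum_O. apply H.
  - rewrite sum_Sn. unfold plus; simpl. generalize (H (S n)); lra.
Qed.

Lemma ex_series_telescope (x V : nat -> R) :
  (forall k, 0 <= x k) -> (forall k, 0 <= V k) ->
  (forall k, x k <= V k - V (S k)) -> ex_series x.
Proof.
  intros H0 HV H.
  apply ex_finite_lim_seq_incr with (M := V 0%nat).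
  - intros n. rewrite sum_Sn. unfold plus; simpl. generalize (H0 (S n)); lra.
  - intros n. apply Rle_trans with (V 0%nat - V (S n)).
    + now apply sum_n_le_telescope.
    + generalize (HV (S n)); lra.
Qed.

Lemma telescope_le_Series (x V : nat -> R) :
  ex_series x -> is_lim_seq V 0 ->
  (forall k, V k - V (S k) <= x k) -> V 0%nat <= Series x.
Proof.
  intros Hx HV H.
  apply (is_lim_seq_le (fun n => V 0%nat - V (S n)) (sum_n x)
           (V 0%nat) (Series x)).
  - intros n. now apply telescope_le_sum_n.
  - replace (Finite (V 0%nat)) with (Finite (V 0%nat - 0)) by (f_equal; ring).
    apply is_lim_seq_minus'; [apply is_lim_seq_const |].
    now apply is_lim_seq_incr_1 in HV.
  - apply Series_correct, Hx.
Qed.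

(** * The Hermite-Hadamard inequalities *)

Lemma is_derive_reflect (f : R -> R) (m x l : R) :
  is_derive f (m - x) l -> is_derive (fun y => f (m - y)) x (- l).
Proof.
  intros D. replace (- l) with (scal (-1) l)
    by (unfold scal; simpl; unfold mult; simpl; ring).
  apply (is_derive_comp f (fun y => m - y)); [exact D |].
  auto_derive; auto; ring.
Qed.

Lemma is_derive_shift (f : R -> R) (m x l : R) :
  is_derive f (m + x) l -> is_derive (fun y => f (m + y)) x l.
Proof.
  intros D. replace l with (scal 1 l)
    by (unfold scal; simpl; unfold mult; simpl; ring).
  apply (is_derive_comp f (fun y => m + y)); [exact D |].
  auto_derive; auto; ring.
Qed.

(** Both sides agree at h = 0, and the derivative in h of their difference is
    G (m - h) + G (m + h) - 2 G m, which is nonnegative by convexity. *)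
Lemma midpoint_le (F G G1 : R -> R) (m h : R) :
  0 <= h ->
  (forall z, m - h <= z <= m + h -> is_derive F z (- G z)) ->
  (forall z, m - h <= z <= m + h -> is_derive G z (G1 z)) ->
  (forall y z, m - h <= y -> y <= z -> z <= m + h -> G1 y <= G1 z) ->
  2 * h * G m <= F (m - h) - F (m + h).
Proof.
  intros Hh HF HG Hm.
  assert (HH : forall y, 0 <= y <= h ->
    0 <= G (m - y) + G (m + y) - 2 * G m).
  { intros y Hy.
    assert (E := nondecreasing_of_derive
      (fun y => G (m - y) + G (m + y))
      (fun y => - G1 (m - y) + G1 (m + y)) 0 y).
    cbv beta in E. rewrite Rminus_0_r, Rplus_0_r in E.
    enough (G m + G m <= G (m - y) + G (m + y)) by lra.
    apply E; [lra | |].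
    - intros x Hx.
      apply (is_derive_plus (fun y => G (m - y)) (fun y => G (m + y))).
      + apply is_derive_reflect, HG; lra.
      + apply is_derive_shift, HG; lra.
    - intros x Hx. enough (G1 (m - x) <= G1 (m + x)) by lra.
      apply Hm; lra. }
  assert (E := nondecreasing_of_derive
      (fun y => F (m - y) - F (m + y) - 2 * G m * y)
      (fun y => G (m - y) + G (m + y) - 2 * G m) 0 h).
  cbv beta in E. rewrite Rminus_0_r, Rplus_0_r in E.
  enough (F m - F m - 2 * G m * 0 <= F (m - h) - F (m + h) - 2 * G m * h)
    by lra.
  apply E; [lra | | exact HH].
  intros x Hx.
  assert (D1 := is_derive_reflect F m x _ (HF (m - x) ltac:(lra))).
  assert (D2 := is_derive_shift F m x _ (HF (m + x) ltac:(lra))).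
  assert (D3 : is_derive (fun y => 2 * G m * y) x (2 * G m))
    by (auto_derive; auto; ring).
  generalize (is_derive_minus _ _ _ _ _
    (is_derive_minus _ _ _ _ _ D1 D2) D3).
  unfold minus, plus, opp; simpl.
  intros D; evar_last; [apply D | simpl; ring].
Qed.

(** Both sides agree at h = 0, and the derivative in h of their difference is
    h (G1 (m + h) - G1 (m - h)), which is nonnegative by convexity. *)
Lemma le_trapezoid (F G G1 : R -> R) (m h : R) :
  0 <= h ->
  (forall z, m - h <= z <= m + h -> is_derive F z (- G z)) ->
  (forall z, m - h <= z <= m + h -> is_derive G z (G1 z)) ->
  (forall y z, m - h <= y -> y <= z -> z <= m + h -> G1 y <= G1 z) ->
  F (m - h) - F (m + h) <= h * (G (m - h) + G (m + h)).
Proof.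
  intros Hh HF HG Hm.
  assert (E := nondecreasing_of_derive
      (fun y => y * (G (m - y) + G (m + y)) - (F (m - y) - F (m + y)))
      (fun y => y * (G1 (m + y) - G1 (m - y))) 0 h).
  cbv beta in E. rewrite Rminus_0_r, Rplus_0_r in E.
  enough (0 * (G m + G m) - (F m - F m)
          <= h * (G (m - h) + G (m + h)) - (F (m - h) - F (m + h))) by lra.
  apply E; [lra | |].
  - intros x Hx.
    assert (D1 := is_derive_reflect F m x _ (HF (m - x) ltac:(lra))).
    assert (D2 := is_derive_shift F m x _ (HF (m + x) ltac:(lra))).
    assert (D3 := is_derive_reflect G m x _ (HG (m - x) ltac:(lra))).
    assert (D4 := is_derive_shift G m x _ (HG (m + x) ltac:(lra))).
    generalize (is_derive_minus _ _ _ _ _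
      (is_derive_mult _ _ _ _ _ (is_derive_id x)
         (is_derive_plus _ _ _ _ _ D3 D4) Rmult_comm)
      (is_derive_minus _ _ _ _ _ D1 D2)).
    unfold minus, plus, opp, mult, one; simpl.
    intros D; evar_last; [apply D | simpl; ring].
  - intros x Hx. apply Rmult_le_pos; [lra |].
    enough (G1 (m - x) <= G1 (m + x)) by lra. apply Hm; lra.
Qed.

(** * Quadrature over the squares of the nodes *)

Definition node (u : R) (k : nat) : R := INR (k + 1) + u.

Lemma node_0 (u : R) : node u 0 = 1 + u.
Proof. unfold node; simpl; ring. Qed.

Lemma node_S (u : R) (k : nat) : node u (S k) = node u k + 1.
Proof.
  unfold node. replace (S k + 1)%nat with (S (k + 1)) by lia.
  rewrite S_INR; ring.
Qed.

Lemma node_eq (u : R) (k : nat) : INR k + 1 + u = node u k.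
Proof. unfold node. rewrite plus_INR; simpl; ring. Qed.

Lemma node_lower (u : R) (k : nat) : 1 + u <= node u k.
Proof. rewrite <- node_eq. generalize (pos_INR k); lra. Qed.

Lemma is_lim_seq_node_sqr (u : R) :
  0 <= u -> is_lim_seq (fun k => node u k ^ 2) p_infty.
Proof.
  intros Hu. apply (is_lim_seq_le_p_loc INR); [| apply is_lim_seq_INR].
  exists 0%nat. intros k _. rewrite <- node_eq.
  generalize (pos_INR k); nra.
Qed.

(** [F] is the tail integral of [G] and [G1] its derivative; convexity of [G]
    is the monotonicity of [G1]. *)
Definition convex_density (F G G1 : R -> R) (c : R) : Prop :=
  (forall z, c <= z -> is_derive F z (- G z)) /\
  (forall z, c <= z -> is_derive G z (G1 z)) /\
  (forall y z, c <= y -> y <= z -> G1 y <= G1 z) /\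
  (forall z, c <= z -> 0 <= F z) /\
  (forall z, c <= z -> 0 <= G z) /\
  is_lim F p_infty 0.

Definition quad_term (G : R -> R) (u : R) (k : nat) : R :=
  2 * node u k * G (node u k ^ 2).

Section Quadrature.

Context (F G G1 : R -> R) (c u : R).
Hypothesis Hu : 0 <= u.
Hypothesis HFG : convex_density F G G1 c.

Lemma quad_term_nonneg (k : nat) : c <= (1 + u) ^ 2 -> 0 <= quad_term G u k.
Proof.
  intros Hc. destruct HFG as (_ & _ & _ & _ & HG & _).
  assert (Hn := node_lower u k). unfold quad_term.
  apply Rmult_le_pos; [lra | apply HG; nra].
Qed.

(** The midpoint inequality at m = a^2 with h = a; the right end
    a (a + 1) of the interval is the left end of the next one. *)
Lemma quad_term_le (k : nat) : c <= u ^ 2 + u ->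
  quad_term G u k <=
  F (node u k * (node u k - 1)) - F (node u (S k) * (node u (S k) - 1)).
Proof.
  intros Hc. destruct HFG as (HF & HG & Hm & _).
  assert (Hn := node_lower u k). rewrite node_S. unfold quad_term.
  set (a := node u k) in *.
  replace (a * (a - 1)) with (a ^ 2 - a) by ring.
  replace ((a + 1) * (a + 1 - 1)) with (a ^ 2 + a) by ring.
  assert (c <= a ^ 2 - a) by nra.
  apply (midpoint_le F G G1); intros; [lra | apply HF | apply HG | apply Hm]; lra.
Qed.

Lemma ex_series_quad : c <= u ^ 2 + u -> ex_series (quad_term G u).
Proof.
  intros Hc.
  apply (ex_series_telescope _ (fun k => F (node u k * (node u k - 1)))).
  - intros k. apply quad_term_nonneg; nra.
  - intros k. destruct HFG as (_ & _ & _ & HF & _).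
    apply HF. assert (Hn := node_lower u k). nra.
  - intros k. now apply quad_term_le.
Qed.

Lemma sum_quad_le (n : nat) : c <= u ^ 2 + u ->
  sum_n (quad_term G u) n <= F (u ^ 2 + u).
Proof.
  intros Hc.
  apply Rle_trans with (1 := sum_n_le_telescope _
    (fun k => F (node u k * (node u k - 1))) n (fun k => quad_term_le k Hc)).
  rewrite node_0. replace ((1 + u) * (1 + u - 1)) with (u ^ 2 + u) by ring.
  enough (0 <= F (node u (S n) * (node u (S n) - 1))) by lra.
  destruct HFG as (_ & _ & _ & HF & _).
  apply HF. assert (Hn := node_lower u (S n)). nra.
Qed.

(** The trapezoid inequality makes F (a^2) + (a - 1/2) G (a^2) a telescoping
    minorant: the correction by half an interval shares the weight 2 a
    between the two intervals adjacent to a^2. *)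
Lemma le_Series_quad : c <= (1 + u) ^ 2 ->
  ex_series (quad_term G u) -> F ((1 + u) ^ 2) <= Series (quad_term G u).
Proof.
  intros Hc Hex.
  assert (Hnode : forall k, c <= node u k ^ 2)
    by (intros k; assert (Hn := node_lower u k); nra).
  destruct HFG as (HF & HG & Hm & HF0 & HG0 & Hlim).
  set (V := fun k => F (node u k ^ 2) + (node u k - 1 / 2) * G (node u k ^ 2)).
  apply Rle_trans with (V 0%nat).
  - unfold V. rewrite node_0.
    assert (0 <= G ((1 + u) ^ 2)) by (apply HG0; lra). nra.
  - apply telescope_le_Series; [exact Hex | |].
    + unfold V. replace (Finite 0) with (Finite (0 + 0)) by (f_equal; ring).
      apply is_lim_seq_plus'.
      * apply (is_lim_comp_seq F (fun k => node u k ^ 2) p_infty 0 Hlim).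
        -- exists 0%nat. intros; discriminate.
        -- now apply is_lim_seq_node_sqr.
      * apply (is_lim_seq_le_le (fun _ => 0) _ (quad_term G u)).
        -- intros k. assert (Hn := node_lower u k).
           assert (0 <= G (node u k ^ 2)) by (apply HG0; auto).
           unfold quad_term. nra.
        -- apply is_lim_seq_const.
        -- now apply ex_series_lim_0.
    + intros k. unfold V, quad_term. rewrite node_S.
      assert (Hn := node_lower u k). specialize (Hnode k).
      set (a := node u k) in *.
      assert (E := le_trapezoid F G G1 (a ^ 2 + a + 1 / 2) (a + 1 / 2)).
      replace (a ^ 2 + a + 1 / 2 - (a + 1 / 2)) with (a ^ 2) in E by field.
      replace (a ^ 2 + a + 1 / 2 + (a + 1 / 2)) with ((a + 1) ^ 2) in E by field.
      enough (F (a ^ 2) - F ((a + 1) ^ 2)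
              <= (a + 1 / 2) * (G (a ^ 2) + G ((a + 1) ^ 2))) by lra.
      apply E; intros; [lra | apply HF | apply HG | apply Hm]; lra.
Qed.

End Quadrature.

(** * The two families of convex densities *)

Lemma Rpower_pos (z c : R) : 0 < Rpower z c.
Proof. apply exp_pos. Qed.

Lemma Rpower_succ (z c : R) : 0 < z -> Rpower z (c + 1) = Rpower z c * z.
Proof. intros Hz. now rewrite Rpower_plus, Rpower_1. Qed.

Lemma is_derive_inv_Rpower (c T z : R) : 0 < z + T ->
  is_derive (fun z => / Rpower (z + T) c) z (- c * / Rpower (z + T) (c + 1)).
Proof.
  intros Hz. rewrite Rpower_succ by assumption.
  unfold Rpower. auto_derive.
  - split; [assumption |]. split; [| auto]. apply Rgt_not_eq, exp_pos.
  - field. split; [lra |]. apply Rgt_not_eq, exp_pos.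
Qed.

Lemma inv_Rpower_antitone (c y z : R) :
  0 <= c -> 0 < y <= z -> / Rpower z c <= / Rpower y c.
Proof.
  intros Hc Hy. apply Rinv_le_contravar; [apply Rpower_pos |].
  now apply Rle_Rpower_l.
Qed.

Lemma is_lim_inv_Rpower (c T : R) : 0 < c ->
  is_lim (fun z => / Rpower (z + T) c) p_infty 0.
Proof.
  intros Hc.
  apply (is_lim_ext (fun z => exp (- (c * ln (z + T))))).
  { intros z. unfold Rpower. now rewrite exp_Ropp. }
  apply (is_lim_comp exp _ p_infty 0 m_infty); [apply is_lim_exp_m | |].
  - replace m_infty with (Rbar_opp p_infty) by reflexivity.
    apply is_lim_opp.
    replace p_infty with (Rbar_mult c p_infty) at 2.
    + apply is_lim_scal_l.
      apply (is_lim_comp ln (fun z => z + T) p_infty p_infty p_infty).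
      * apply is_lim_ln_p.
      * replace p_infty with (Rbar_plus p_infty T) at 2 by reflexivity.
        apply is_lim_plus with (lf := p_infty) (lg := T);
          [apply is_lim_id | apply is_lim_const | reflexivity].
      * exists 0. intros; discriminate.
    + simpl. case Rle_dec; [| lra]. intros H.
      case Rle_lt_or_eq_dec; intros; [reflexivity | lra].
  - exists 0. intros; discriminate.
Qed.

Lemma convex_density_power (nu T c : R) : 0 < nu -> 0 < c + T ->
  convex_density (fun z => / nu * / Rpower (z + T) nu)
    (fun z => / Rpower (z + T) (nu + 1))
    (fun z => - (nu + 1) * / Rpower (z + T) (nu + 1 + 1)) c.
Proof.
  intros Hnu Hc. repeat apply conj.
  - intros z Hz. evar_last.
    + apply is_derive_scal, is_derive_inv_Rpower. lra.
    + field. split; [| lra]. apply Rgt_not_eq, Rpower_pos.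
  - intros z Hz. apply is_derive_inv_Rpower. lra.
  - intros y z Hy Hyz.
    assert (/ Rpower (z + T) (nu + 1 + 1) <= / Rpower (y + T) (nu + 1 + 1))
      by (apply inv_Rpower_antitone; lra).
    nra.
  - intros z _. apply Rlt_le, Rmult_lt_0_compat; apply Rinv_0_lt_compat;
      [assumption | apply Rpower_pos].
  - intros z _. apply Rlt_le, Rinv_0_lt_compat, Rpower_pos.
  - replace (Finite 0) with (Rbar_mult (/ nu) 0)
      by (simpl; f_equal; ring).
    now apply is_lim_scal_l, is_lim_inv_Rpower.
Qed.

Lemma convex_density_exp (x c : R) : 0 < x ->
  convex_density (fun z => exp (- z * x)) (fun z => x * exp (- z * x))
    (fun z => - x ^ 2 * exp (- z * x)) c.
Proof.
  intros Hx. repeat apply conj.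
  - intros z _. auto_derive; [auto | ring].
  - intros z _. auto_derive; [auto | ring].
  - intros y z _ Hyz.
    enough (exp (- z * x) <= exp (- y * x)) by nra.
    apply exp_le_exp. nra.
  - intros; apply Rlt_le, exp_pos.
  - intros; apply Rmult_le_pos; [lra | apply Rlt_le, exp_pos].
  - apply (is_lim_comp exp _ p_infty 0 m_infty); [apply is_lim_exp_m | |].
    + apply (is_lim_ext (fun z => - x * z)); [intros; ring |].
      replace m_infty with (Rbar_mult (- x) p_infty).
      * apply is_lim_scal_l, is_lim_id.
      * simpl. case Rle_dec; intros H; [exfalso; lra | reflexivity].
    + exists 0. intros; discriminate.
Qed.

(** * The power sums and their derivative *)

Lemma Series_mono (x y : nat -> R) :
  ex_series x -> ex_series y -> (forall k, x k <= y k) -> Series x <= Series y.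
Proof.
  intros Hx Hy H.
  apply (is_lim_seq_le (sum_n x) (sum_n y) (Series x) (Series y)).
  - intros n. now apply sum_n_m_le.
  - apply Series_correct, Hx.
  - apply Series_correct, Hy.
Qed.

Definition power_sum (nu T u : R) : R :=
  Series (quad_term (fun z => / Rpower (z + T) (nu + 1)) u).

Lemma S_mu_power_sum (mu t u : R) : S_mu mu t u = power_sum mu (t ^ 2) u.
Proof. reflexivity. Qed.

(** The first term is split off: at u = T = 0 the tail integral of the
    density diverges at q = 0, so the midpoint comparison starts at the
    second node. *)
Lemma ex_series_power (nu T u : R) : 0 <= u -> 0 < nu -> 0 <= T ->
  ex_series (quad_term (fun z => / Rpower (z + T) (nu + 1)) u).
Proof.
  intros Hu Hnu HT. apply ex_series_incr_1.
  apply (ex_series_ext (quad_term (fun z => / Rpower (z + T) (nu + 1)) (u + 1))).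
  { intros k. unfold quad_term. rewrite node_S.
    replace (node (u + 1) k) with (node u k + 1) by (unfold node; ring).
    reflexivity. }
  eapply ex_series_quad; [lra | |].
  - apply (convex_density_power nu T 1); lra.
  - nra.
Qed.

Lemma power_sum_ge (nu T u : R) : 0 <= u -> 0 < nu -> 0 <= T ->
  / nu * / Rpower ((1 + u) ^ 2 + T) nu <= power_sum nu T u.
Proof.
  intros Hu Hnu HT.
  apply (le_Series_quad (fun z => / nu * / Rpower (z + T) nu) _ _ 1 u Hu
    (convex_density_power nu T 1 Hnu ltac:(lra))).
  - nra.
  - now apply ex_series_power.
Qed.

Lemma power_sum_pos (nu T u : R) : 0 <= u -> 0 < nu -> 0 <= T ->
  0 < power_sum nu T u.
Proof.
  intros Hu Hnu HT. eapply Rlt_le_trans; [| now apply power_sum_ge].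
  apply Rmult_lt_0_compat; apply Rinv_0_lt_compat; [lra | apply Rpower_pos].
Qed.

(** Convexity of z^(-c), from exp w >= 1 + w and ln r <= r - 1 with
    r = z / y. *)
Lemma inv_Rpower_tangent (c y z : R) : 0 <= c -> 0 < y -> 0 < z ->
  / Rpower y c - c * (z - y) * / Rpower y (c + 1) <= / Rpower z c.
Proof.
  intros Hc Hy Hz. rewrite Rpower_succ by assumption.
  unfold Rpower. rewrite Rinv_mult, <- !exp_Ropp.
  replace (- (c * ln z)) with (- (c * ln y) + - (c * ln (z / y)))
    by (rewrite ln_div by assumption; ring).
  rewrite exp_plus.
  set (E := exp (- (c * ln y))). assert (HE : 0 < E) by apply exp_pos.
  assert (Hr : 0 < z / y) by (apply Rdiv_lt_0_compat; assumption).
  assert (H1 : ln (z / y) <= z / y - 1).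
  { generalize (exp_ineq1_le (ln (z / y))). rewrite exp_ln by assumption. lra. }
  assert (H2 := exp_ineq1_le (- (c * ln (z / y)))).
  replace (E - c * (z - y) * (E * / y)) with (E * (1 - c * (z / y - 1)))
    by (field; lra).
  apply Rmult_le_compat_l; [lra | nra].
Qed.

(** The tangent inequality passes to the sum term by term.  It replaces
    uniform convergence arguments: used at both ends of an increment, it
    yields Lipschitz continuity and then differentiability. *)
Lemma power_sum_tangent (nu T T' u : R) : 0 <= u -> 0 < nu -> 0 <= T -> 0 <= T' ->
  power_sum nu T u - (nu + 1) * (T' - T) * power_sum (nu + 1) T u
    <= power_sum nu T' u.
Proof.
  intros Hu Hnu HT HT'. unfold power_sum.
  rewrite <- Series_scal_l, <- Series_minus.
  - apply Series_mono.
    + apply (ex_series_minus (V := R_NormedModule)).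
      * now apply ex_series_power.
      * apply (ex_series_scal_l (V := R_NormedModule)), ex_series_power; lra.
    + now apply ex_series_power.
    + intros k. unfold quad_term. assert (Hn := node_lower u k).
      set (a := node u k) in *.
      assert (E := inv_Rpower_tangent (nu + 1) (a ^ 2 + T) (a ^ 2 + T')
        ltac:(lra) ltac:(nra) ltac:(nra)).
      replace (a ^ 2 + T' - (a ^ 2 + T)) with (T' - T) in E by ring.
      apply (Rmult_le_compat_l (2 * a)) in E; lra.
  - now apply ex_series_power.
  - apply (ex_series_scal_l (V := R_NormedModule)), ex_series_power; lra.
Qed.

Lemma power_sum_antitone (nu T T' u : R) : 0 <= u -> 0 < nu -> 0 <= T -> T <= T' ->
  power_sum nu T' u <= power_sum nu T u.
Proof.
  intros Hu Hnu HT HTT'.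
  assert (E := power_sum_tangent nu T' T u Hu Hnu ltac:(lra) HT).
  assert (P := power_sum_pos (nu + 1) T' u Hu ltac:(lra) ltac:(lra)).
  assert (0 <= (nu + 1) * (T' - T) * power_sum (nu + 1) T' u)
    by (repeat apply Rmult_le_pos; lra).
  lra.
Qed.

Lemma power_sum_lipschitz (nu T T' u : R) :
  0 <= u -> 0 < nu -> 0 <= T -> 0 <= T' ->
  Rabs (power_sum nu T' u - power_sum nu T u)
    <= (nu + 1) * power_sum (nu + 1) 0 u * Rabs (T' - T).
Proof.
  intros Hu Hnu HT HT'.
  assert (E1 := power_sum_tangent nu T T' u Hu Hnu HT HT').
  assert (E2 := power_sum_tangent nu T' T u Hu Hnu HT' HT).
  assert (P1 := power_sum_pos (nu + 1) T u Hu ltac:(lra) ltac:(lra)).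
  assert (P2 := power_sum_pos (nu + 1) T' u Hu ltac:(lra) ltac:(lra)).
  assert (A1 := power_sum_antitone (nu + 1) 0 T u Hu ltac:(lra) ltac:(lra) HT).
  assert (A2 := power_sum_antitone (nu + 1) 0 T' u Hu ltac:(lra) ltac:(lra) HT').
  set (K := power_sum (nu + 1) T u) in *. set (K' := power_sum (nu + 1) T' u) in *.
  set (K0 := power_sum (nu + 1) 0 u) in *.
  unfold Rabs at 2. destruct (Rcase_abs (T' - T)) as [H | H].
  - assert (0 <= (nu + 1) * (T - T') * K') by (repeat apply Rmult_le_pos; lra).
    assert ((nu + 1) * (T - T') * K <= (nu + 1) * (T - T') * K0)
      by (apply Rmult_le_compat_l; [apply Rmult_le_pos|]; lra).
    assert ((nu + 1) * (T - T') * K' <= (nu + 1) * (T - T') * K0)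
      by (apply Rmult_le_compat_l; [apply Rmult_le_pos|]; lra).
    apply Rabs_le; split; nra.
  - assert (0 <= (nu + 1) * (T' - T) * K) by (repeat apply Rmult_le_pos; lra).
    assert ((nu + 1) * (T' - T) * K <= (nu + 1) * (T' - T) * K0)
      by (apply Rmult_le_compat_l; [apply Rmult_le_pos|]; lra).
    assert ((nu + 1) * (T' - T) * K' <= (nu + 1) * (T' - T) * K0)
      by (apply Rmult_le_compat_l; [apply Rmult_le_pos|]; lra).
    apply Rabs_le; split; nra.
Qed.

Lemma is_derive_of_quadratic_error (f : R -> R) (x l C d : R) :
  0 < d ->
  (forall y, Rabs (y - x) < d ->
     Rabs (f y - f x - l * (y - x)) <= C * (y - x) ^ 2) ->
  is_derive f x l.
Proof.
  intros Hd H. apply is_derive_Reals. intros eps Heps.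
  assert (Hm : 0 < Rmin d (eps / (Rabs C + 1))).
  { apply Rmin_glb_lt; [assumption |].
    apply Rdiv_lt_0_compat; [assumption |]. generalize (Rabs_pos C); lra. }
  exists (mkposreal _ Hm). intros h Hh Hlt. simpl in Hlt.
  assert (Hlt1 := Rlt_le_trans _ _ _ Hlt (Rmin_l _ _)).
  assert (Hlt2 := Rlt_le_trans _ _ _ Hlt (Rmin_r _ _)).
  specialize (H (x + h)). replace (x + h - x) with h in H by ring.
  specialize (H Hlt1).
  replace ((f (x + h) - f x) / h - l) with ((f (x + h) - f x - l * h) / h)
    by (field; assumption).
  assert (Hp : 0 < Rabs h) by now apply Rabs_pos_lt.
  unfold Rdiv. rewrite Rabs_mult, Rabs_inv.
  apply Rmult_lt_reg_r with (Rabs h); [assumption |].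
  rewrite Rmult_assoc, Rinv_l, Rmult_1_r by lra.
  apply Rle_lt_trans with (1 := H).
  rewrite <- (pow2_abs h).
  assert (HC := Rle_abs C). assert (HC0 := Rabs_pos C).
  apply Rlt_div_r in Hlt2; [| lra]. nra.
Qed.

(** The increment lies between the tangent slopes at its two ends, and these
    slopes differ by at most a constant times the increment. *)
Lemma is_derive_power_sum (nu T u : R) : 0 <= u -> 0 < nu -> 0 < T ->
  is_derive (fun T => power_sum nu T u) T (- (nu + 1) * power_sum (nu + 1) T u).
Proof.
  intros Hu Hnu HT.
  apply (is_derive_of_quadratic_error _ _ _
    ((nu + 1) * ((nu + 1 + 1) * power_sum (nu + 1 + 1) 0 u)) T HT).
  intros T' HT'. apply Rabs_def2 in HT'.
  assert (E1 := power_sum_tangent nu T T' u Hu Hnu ltac:(lra) ltac:(lra)).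
  assert (E2 := power_sum_tangent nu T' T u Hu Hnu ltac:(lra) ltac:(lra)).
  assert (L := power_sum_lipschitz (nu + 1) T T' u Hu ltac:(lra) ltac:(lra) ltac:(lra)).
  set (K' := power_sum (nu + 1) T' u) in *.
  set (K := power_sum (nu + 1) T u) in *.
  set (C := (nu + 1 + 1) * power_sum (nu + 1 + 1) 0 u) in *.
  apply Rle_trans with ((nu + 1) * (Rabs (K' - K) * Rabs (T' - T))).
  - rewrite <- Rabs_mult. rewrite Rabs_pos_eq by lra.
    apply Rle_trans with ((nu + 1) * - ((K' - K) * (T' - T))); [lra |].
    apply Rmult_le_compat_l; [lra |]. rewrite <- Rabs_Ropp. apply Rle_abs.
  - rewrite <- (pow2_abs (T' - T)), Rmult_assoc.
    apply Rmult_le_compat_l; [lra |].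
    replace (C * Rabs (T' - T) ^ 2) with (C * Rabs (T' - T) * Rabs (T' - T)) by ring.
    apply Rmult_le_compat_r; [apply Rabs_pos | exact L].
Qed.

(** * Complete monotonicity as positivity along a progression of indices *)

Lemma psi_power_sum (p u mu t : R) : 0 < t ->
  psi p u mu t = / mu * / Rpower (p + t) mu - power_sum mu t u.
Proof.
  intros Ht. unfold psi. rewrite S_mu_power_sum, pow2_sqrt by lra.
  unfold Rdiv. now rewrite Rinv_mult, Rmult_1_l.
Qed.

Lemma is_derive_psi (p u mu t : R) : 0 <= p -> 0 <= u -> 0 < mu -> 0 < t ->
  is_derive (psi p u mu) t (- (mu + 1) * psi p u (mu + 1) t).
Proof.
  intros Hp Hu Hmu Ht.
  apply (is_derive_ext_loc
    (fun t => / mu * / Rpower (t + p) mu - power_sum mu t u)).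
  - exists (mkposreal t Ht). intros y Hy. apply Rabs_def2 in Hy.
    unfold minus, plus, opp in Hy; simpl in Hy.
    rewrite psi_power_sum, (Rplus_comm p) by lra. reflexivity.
  - rewrite psi_power_sum by assumption. evar_last.
    + apply (is_derive_minus (fun t => / mu * / Rpower (t + p) mu)
        (fun t => power_sum mu t u)).
      * apply is_derive_scal, is_derive_inv_Rpower; lra.
      * now apply is_derive_power_sum.
    + unfold minus, plus, opp; simpl. rewrite (Rplus_comm p t).
      field. split; [apply Rgt_not_eq, Rpower_pos | lra].
Qed.

(** The constant c is (mu + 1) ... (mu + k), of which only the sign
    matters. *)
Lemma Derive_n_psi (p u mu : R) (k : nat) : 0 <= p -> 0 <= u -> 0 < mu ->
  exists c, 0 < c /\ forall t, 0 < t ->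
    ex_derive_n (psi p u mu) k t /\
    Derive_n (psi p u mu) k t = (-1) ^ k * c * psi p u (mu + INR k) t.
Proof.
  intros Hp Hu Hmu. induction k as [|k [c [Hc IH]]].
  - exists 1. split; [lra |]. intros t Ht. split; [exact I |].
    simpl. rewrite Rplus_0_r. ring.
  - assert (Hk := pos_INR k).
    exists (c * (mu + INR k + 1)). split; [apply Rmult_lt_0_compat; lra |].
    intros t Ht.
    assert (D : is_derive (Derive_n (psi p u mu) k) t
      ((-1) ^ k * c * (- (mu + INR k + 1) * psi p u (mu + INR k + 1) t))).
    { apply (is_derive_ext_loc (fun t => (-1) ^ k * c * psi p u (mu + INR k) t)).
      - exists (mkposreal t Ht). intros y Hy. apply Rabs_def2 in Hy.
        unfold minus, plus, opp in Hy; simpl in Hy.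
        symmetry. apply IH. lra.
      - apply is_derive_scal, is_derive_psi; lra. }
    split; [eexists; exact D |].
    simpl Derive_n. rewrite (is_derive_unique _ _ _ D).
    rewrite S_INR. replace (mu + (INR k + 1)) with (mu + INR k + 1) by ring.
    simpl pow. ring.
Qed.

Lemma sign_sqr (k : nat) : (-1) ^ k * (-1) ^ k = 1.
Proof. rewrite <- Rpow_mult_distr. replace (-1 * -1) with 1 by ring. apply pow1. Qed.

Lemma completely_monotonic_psi (p u mu : R) : 0 <= p -> 0 <= u -> 0 < mu ->
  (completely_monotonic (psi p u mu) <->
   forall (k : nat) t, 0 < t -> 0 <= psi p u (mu + INR k) t).
Proof.
  intros Hp Hu Hmu. split; intros H k t Ht;
    destruct (Derive_n_psi p u mu k Hp Hu Hmu) as [c [Hc D]];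
    destruct (D t Ht) as [D1 D2].
  - destruct (H k t Ht) as [_ Hk]. rewrite D2, !Rmult_assoc in Hk.
    rewrite <- Rmult_assoc, sign_sqr in Hk. nra.
  - split; [assumption |].
    rewrite D2, !Rmult_assoc, <- Rmult_assoc, sign_sqr, Rmult_1_l.
    apply Rmult_le_pos; [lra | auto].
Qed.

Lemma completely_monotonic_opp_psi (p u mu : R) : 0 <= p -> 0 <= u -> 0 < mu ->
  (completely_monotonic (fun t => - psi p u mu t) <->
   forall (k : nat) t, 0 < t -> psi p u (mu + INR k) t <= 0).
Proof.
  intros Hp Hu Hmu. split; intros H k t Ht;
    destruct (Derive_n_psi p u mu k Hp Hu Hmu) as [c [Hc D]];
    destruct (D t Ht) as [D1 D2].
  - destruct (H k t Ht) as [_ Hk].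
    rewrite Derive_n_opp, D2, Ropp_mult_distr_r_reverse, !Rmult_assoc in Hk.
    rewrite <- Rmult_assoc, sign_sqr in Hk. nra.
  - split; [now apply ex_derive_n_opp |].
    rewrite Derive_n_opp, D2, Ropp_mult_distr_r_reverse, !Rmult_assoc.
    rewrite <- Rmult_assoc, sign_sqr, Rmult_1_l.
    specialize (H k t Ht). nra.
Qed.

(** * From the power sums to phi: Post-Widder inversion *)

Definition exp_sum (x u : R) : R :=
  Series (quad_term (fun z => x * exp (- z * x)) u).

Lemma phi_exp_sum (u x : R) : phi u x = exp_sum x u.
Proof.
  unfold phi, exp_sum. rewrite <- Series_scal_l. apply Series_ext. intros k.
  unfold quad_term, node. ring.
Qed.

Lemma ex_series_exp (x u : R) : 0 <= u -> 0 < x ->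
  ex_series (quad_term (fun z => x * exp (- z * x)) u).
Proof.
  intros Hu Hx. eapply ex_series_quad; [assumption | |].
  - now apply (convex_density_exp x 0).
  - nra.
Qed.

Lemma phi_ge (u x : R) : 0 <= u -> 0 < x -> exp (- (1 + u) ^ 2 * x) <= phi u x.
Proof.
  intros Hu Hx. rewrite phi_exp_sum.
  apply (le_Series_quad (fun z => exp (- z * x)) _ _ 0 u Hu
    (convex_density_exp x 0 Hx)).
  - nra.
  - now apply ex_series_exp.
Qed.

Lemma phi_pos (u x : R) : 0 <= u -> 0 < x -> 0 < phi u x.
Proof.
  intros Hu Hx. eapply Rlt_le_trans; [apply exp_pos | now apply phi_ge].
Qed.

Lemma is_lim_seq_inv_shift (mu : R) : is_lim_seq (fun n => / (mu + INR n)) 0.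
Proof.
  change (Finite 0) with (Rbar_inv p_infty).
  apply is_lim_seq_inv; [| discriminate].
  apply is_lim_seq_plus with mu p_infty;
    [apply is_lim_seq_const | apply is_lim_seq_INR | reflexivity].
Qed.

Lemma is_lim_seq_sum_n (f : nat -> nat -> R) (l : nat -> R) (N : nat) :
  (forall k, is_lim_seq (fun n => f n k) (l k)) ->
  is_lim_seq (fun n => sum_n (f n) N) (sum_n l N).
Proof.
  intros H. induction N as [|N IH].
  - rewrite sum_O. apply is_lim_seq_ext with (2 := H 0%nat).
    intros n. now rewrite sum_O.
  - rewrite sum_Sn. apply is_lim_seq_ext with (fun n => sum_n (f n) N + f n (S N)).
    + intros n. now rewrite sum_Sn.
    + now apply is_lim_seq_plus'.
Qed.

(** With t = nu / x, the right side is
    x (1 + b x / nu)^(- nu - 1), and ln (1 + w) <= w. *)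
Lemma exp_le_scaled_power (nu x b : R) : 0 < nu -> 0 < x -> 0 <= b ->
  x * exp (- (b * x) * (1 + / nu))
    <= nu * Rpower (nu / x) nu * / Rpower (b + nu / x) (nu + 1).
Proof.
  intros Hnu Hx Hb.
  assert (Ht : 0 < nu / x) by now apply Rdiv_lt_0_compat.
  set (t := nu / x) in *.
  replace (nu * Rpower t nu) with (x * Rpower t (nu + 1)).
  2:{ rewrite Rpower_succ by assumption. unfold t at 2. field. lra. }
  rewrite Rmult_assoc. apply Rmult_le_compat_l; [lra |].
  unfold Rpower. rewrite <- exp_Ropp, <- exp_plus.
  apply exp_le_exp.
  assert (H : ln (b + t) - ln t <= b / t).
  { rewrite <- ln_div by lra.
    replace (b / t) with ((b + t) / t - 1) by (field; lra).
    generalize (exp_ineq1_le (ln ((b + t) / t))).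
    rewrite exp_ln by (apply Rdiv_lt_0_compat; lra). lra. }
  replace (- (b * x) * (1 + / nu)) with (- ((nu + 1) * (b / t)))
    by (unfold t; field; lra).
  enough ((nu + 1) * (ln (b + t) - ln t) <= (nu + 1) * (b / t)) by lra.
  apply Rmult_le_compat_l; lra.
Qed.

(** The left side is (1 + p x / nu)^(- nu), and
    ln (1 + w) >= w / (1 + w). *)
Lemma scaled_power_le_exp (nu x p : R) : 0 < nu -> 0 < x -> 0 <= p ->
  Rpower (nu / x) nu * / Rpower (p + nu / x) nu <= exp (- (p * x) / (1 + p * x * / nu)).
Proof.
  intros Hnu Hx Hp.
  assert (Ht : 0 < nu / x) by now apply Rdiv_lt_0_compat.
  set (t := nu / x) in *.
  unfold Rpower. rewrite <- exp_Ropp, <- exp_plus.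
  apply exp_le_exp.
  assert (H : ln t - ln (p + t) <= - (p / (p + t))).
  { rewrite <- ln_div by lra.
    replace (- (p / (p + t))) with (t / (p + t) - 1) by (field; lra).
    generalize (exp_ineq1_le (ln (t / (p + t)))).
    rewrite exp_ln by (apply Rdiv_lt_0_compat; lra). lra. }
  assert (0 <= p * x) by nra.
  replace (- (p * x) / (1 + p * x * / nu)) with (nu * - (p / (p + t)))
    by (unfold t; field; repeat split; nra).
  enough (nu * (ln t - ln (p + t)) <= nu * - (p / (p + t))) by lra.
  apply Rmult_le_compat_l; lra.
Qed.

(** At t = nu / x, multiply psi_nu (t) >= 0 by nu t^nu and let nu tend to
    infinity: the powers become exponentials.  Finite partial sums suffice,
    so that no exchange of limits is needed. *)
Lemma phi_le_of_psi_nonneg (p u mu : R) : 0 <= p -> 0 <= u -> 0 < mu ->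
  (forall (k : nat) t, 0 < t -> 0 <= psi p u (mu + INR k) t) ->
  forall x, 0 < x -> phi u x <= exp (- p * x).
Proof.
  intros Hp Hu Hmu Hpsi x Hx. rewrite phi_exp_sum.
  apply Series_le_of_partial_sums; [now apply ex_series_exp |]. intros N.
  set (nu := fun k => mu + INR k).
  assert (Hnu : forall k, 0 < nu k)
    by (intros k; unfold nu; generalize (pos_INR k); lra).
  assert (L0 : is_lim_seq (fun k => / nu k) 0) by apply is_lim_seq_inv_shift.
  apply (is_lim_seq_le
    (fun k => sum_n (fun j => 2 * node u j *
        (x * exp (- (node u j ^ 2 * x) * (1 + / nu k)))) N)
    (fun k => exp (- (p * x) / (1 + p * x * / nu k)))
    (sum_n (quad_term (fun z => x * exp (- z * x)) u) N) (exp (- p * x))).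
  - intros k. specialize (Hpsi k (nu k / x)).
    assert (Ht : 0 < nu k / x) by (apply Rdiv_lt_0_compat; auto).
    specialize (Hpsi Ht). rewrite psi_power_sum in Hpsi by assumption.
    fold (nu k) in Hpsi.
    set (A := nu k * Rpower (nu k / x) (nu k)).
    assert (HA : 0 < A) by (apply Rmult_lt_0_compat; [auto | apply Rpower_pos]).
    apply Rle_trans with (A * sum_n (quad_term
       (fun z => / Rpower (z + nu k / x) (nu k + 1)) u) N).
    + rewrite <- (sum_n_mult_l (K := R_Ring)). apply sum_n_m_le. intros j.
      unfold mult; simpl. unfold quad_term.
      assert (Hn := node_lower u j).
      replace (A * (2 * node u j * / Rpower (node u j ^ 2 + nu k / x) (nu k + 1)))
        with (2 * node u j * (A * / Rpower (node u j ^ 2 + nu k / x) (nu k + 1)))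
        by ring.
      apply Rmult_le_compat_l; [lra |].
      apply exp_le_scaled_power; auto. nra.
    + apply Rle_trans with (A * (/ nu k * / Rpower (p + nu k / x) (nu k))).
      * apply Rmult_le_compat_l; [lra |].
        apply Rle_trans with (power_sum (nu k) (nu k / x) u); [| lra].
        apply sum_n_le_Series.
        -- apply ex_series_power; [assumption | auto | lra].
        -- intros j. assert (Hn := node_lower u j). unfold quad_term.
           apply Rmult_le_pos; [lra |].
           apply Rlt_le, Rinv_0_lt_compat, Rpower_pos.
      * replace (A * (/ nu k * / Rpower (p + nu k / x) (nu k)))
          with (Rpower (nu k / x) (nu k) * / Rpower (p + nu k / x) (nu k)).
        -- apply scaled_power_le_exp; auto.
        -- unfold A. field. split; [apply Rgt_not_eq, Rpower_pos |].
           apply Rgt_not_eq, Hnu.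
  - apply is_lim_seq_sum_n. intros j. unfold quad_term.
    apply (is_lim_seq_continuous
      (fun e => 2 * node u j * (x * exp (- (node u j ^ 2 * x) * (1 + e)))) _ 0) in L0.
    + replace (2 * node u j * (x * exp (- node u j ^ 2 * x)))
        with (2 * node u j * (x * exp (- (node u j ^ 2 * x) * (1 + 0))));
        [exact L0 |].
      do 3 f_equal. ring.
    + apply continuity_pt_filterlim.
      apply (ex_derive_continuous
        (fun e => 2 * node u j * (x * exp (- (node u j ^ 2 * x) * (1 + e))))).
      now auto_derive.
  - apply (is_lim_seq_continuous
      (fun e => exp (- (p * x) / (1 + p * x * e))) _ 0) in L0.
    + replace (- p * x) with (- (p * x) / (1 + p * x * 0)) by field.
      exact L0.
    + apply continuity_pt_filterlim.
      apply (ex_derive_continuous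
        (fun e => exp (- (p * x) / (1 + p * x * e)))).
      auto_derive. lra.
Qed.

(** * From phi to the power sums: Euler's integral *)

(** The substitution x = exp v turns the integrand x^(nu-1) exp(- s x) of
    Euler's integral into this function, which is smooth on the whole line
    for every nu > 0. *)
Definition gamma_density (nu s v : R) : R := exp (nu * v - s * exp v).

Definition gamma_cut (nu s : R) (n : nat) : R :=
  RInt (gamma_density nu s) (- INR n) (INR n).

Lemma continuous_gamma_density (nu s v : R) : continuous (gamma_density nu s) v.
Proof.
  apply (ex_derive_continuous (gamma_density nu s)).
  unfold gamma_density. now auto_derive.
Qed.

Lemma ex_RInt_gamma_density (nu s a b : R) : ex_RInt (gamma_density nu s) a b.
Proof.
  apply (ex_RInt_continuous (V := R_CompleteNormedModule)).
  intros; apply continuous_gamma_density.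
Qed.

Lemma RInt_gamma_density_incl (nu s a a' b b' : R) :
  a' <= a -> a <= b -> b <= b' ->
  RInt (gamma_density nu s) a b <= RInt (gamma_density nu s) a' b'.
Proof.
  intros Ha Hab Hb.
  rewrite <- (RInt_Chasles (gamma_density nu s) a' a b')
    by apply ex_RInt_gamma_density.
  rewrite <- (RInt_Chasles (gamma_density nu s) a b b')
    by apply ex_RInt_gamma_density.
  unfold plus; simpl.
  assert (forall c d, c <= d -> 0 <= RInt (gamma_density nu s) c d).
  { intros c d Hcd. apply RInt_ge_0;
      [assumption | apply ex_RInt_gamma_density | intros; apply Rlt_le, exp_pos]. }
  assert (H1 := H a' a Ha). assert (H2 := H b b' Hb). lra.
Qed.

Lemma sqr_le_exp (v : R) : 0 <= v -> v ^ 2 / 4 <= exp v.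
Proof.
  intros Hv. replace (exp v) with (exp (v / 2) * exp (v / 2))
    by (rewrite <- exp_plus; f_equal; field).
  assert (E := exp_ineq1_le (v / 2)). nra.
Qed.

(** The bound is a multiple of the derivative of the logistic function
    - 1 / (1 + exp (nu v)), whose increments are bounded. *)
Lemma gamma_density_le (nu v : R) : 0 < nu ->
  gamma_density nu 1 v
    <= 4 * exp (4 * nu ^ 2) * (exp (nu * v) / (1 + exp (nu * v)) ^ 2).
Proof.
  intros Hnu. unfold gamma_density. rewrite Rmult_1_l.
  unfold Rminus. rewrite exp_plus.
  assert (H0 := exp_pos (nu * v)).
  assert (H4 : 1 <= exp (4 * nu ^ 2)).
  { rewrite <- exp_0. apply exp_le_exp. nra. }
  enough (exp (- exp v) * (1 + exp (nu * v)) ^ 2 <= 4 * exp (4 * nu ^ 2)).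
  { apply Rmult_le_reg_r with ((1 + exp (nu * v)) ^ 2); [nra |].
    replace (4 * exp (4 * nu ^ 2) * (exp (nu * v) / (1 + exp (nu * v)) ^ 2)
              * (1 + exp (nu * v)) ^ 2)
      with (exp (nu * v) * (4 * exp (4 * nu ^ 2))) by (field; lra).
    rewrite Rmult_assoc. apply Rmult_le_compat_l; lra. }
  destruct (Rle_dec v 0) as [Hv | Hv].
  - assert (exp (nu * v) <= 1) by (rewrite <- exp_0; apply exp_le_exp; nra).
    assert (exp (- exp v) <= 1)
      by (rewrite <- exp_0; apply exp_le_exp; generalize (exp_pos v); lra).
    assert (P := exp_pos (- exp v)).
    assert ((1 + exp (nu * v)) ^ 2 <= 4) by nra.
    apply Rle_trans with (1 * 4); [| lra].
    apply Rmult_le_compat; [lra | apply pow2_ge_0 | assumption | assumption].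
  - assert (1 <= exp (nu * v)) by (rewrite <- exp_0; apply exp_le_exp; nra).
    assert (Hq := sqr_le_exp v ltac:(lra)).
    assert (E : exp (- exp v) * (exp (nu * v) * exp (nu * v)) <= exp (4 * nu ^ 2)).
    { rewrite <- !exp_plus. apply exp_le_exp.
      assert (0 <= (v - 4 * nu) ^ 2) by apply pow2_ge_0. nra. }
    assert (P := exp_pos (- exp v)).
    apply Rle_trans with (exp (- exp v) * (4 * (exp (nu * v) * exp (nu * v))));
      [| lra].
    apply Rmult_le_compat_l; [lra | nra].
Qed.

Lemma gamma_cut_bounded (nu : R) (n : nat) : 0 < nu ->
  gamma_cut nu 1 n <= 4 * exp (4 * nu ^ 2) / nu.
Proof.
  intros Hnu. set (C := 4 * exp (4 * nu ^ 2)).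
  assert (HC : 0 < C) by (unfold C; generalize (exp_pos (4 * nu ^ 2)); lra).
  set (L := fun v => - (C / nu) * / (1 + exp (nu * v))).
  assert (Hn := pos_INR n).
  assert (HL : is_RInt (fun v => C * (exp (nu * v) / (1 + exp (nu * v)) ^ 2))
                 (- INR n) (INR n) (minus (L (INR n)) (L (- INR n)))).
  { apply (is_RInt_derive L); intros v _.
    - unfold L. auto_derive; [generalize (exp_pos (nu * v)); lra |].
      field. generalize (exp_pos (nu * v)); lra.
    - apply (ex_derive_continuous (fun v => C * (exp (nu * v) / (1 + exp (nu * v)) ^ 2))).
      auto_derive. generalize (exp_pos (nu * v)); intros; nra. }
  apply Rle_trans with (minus (L (INR n)) (L (- INR n))).
  - rewrite <- (is_RInt_unique _ _ _ _ HL). apply RInt_le.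
    + lra.
    + apply ex_RInt_gamma_density.
    + eexists; exact HL.
    + intros v _. now apply gamma_density_le.
  - unfold minus, plus, opp; simpl. unfold L.
    assert (E1 := exp_pos (nu * INR n)).
    assert (E2 := exp_pos (nu * - INR n)).
    assert (0 < C / nu) by now apply Rdiv_lt_0_compat.
    assert (0 < / (1 + exp (nu * INR n))) by (apply Rinv_0_lt_compat; lra).
    assert (/ (1 + exp (nu * - INR n)) <= 1)
      by (rewrite <- Rinv_1; apply Rinv_le_contravar; lra).
    nra.
Qed.

(** Scaling of the variable x becomes the translation v |-> v + ln s. *)
Lemma gamma_cut_scale (nu s : R) (n : nat) : 0 < s ->
  gamma_cut nu s n =
  / Rpower s nu * RInt (gamma_density nu 1) (- INR n + ln s) (INR n + ln s).
Proof.
  intros Hs. unfold gamma_cut.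
  rewrite <- (RInt_comp (gamma_density nu 1) (fun v => v + ln s) (fun _ => 1)).
  - rewrite <- (RInt_scal (V := R_CompleteNormedModule)).
    + apply RInt_ext. intros v _. unfold scal; simpl; unfold mult; simpl.
      unfold gamma_density, Rpower. rewrite exp_plus, exp_ln by assumption.
      rewrite Rmult_1_l, <- exp_Ropp, <- exp_plus. f_equal. ring.
    + apply (ex_RInt_continuous (V := R_CompleteNormedModule)).
      intros v _.
      apply (ex_derive_continuous
        (fun y => scal 1 (gamma_density nu 1 (y + ln s)))).
      unfold gamma_density, scal; simpl; unfold mult; simpl. now auto_derive.
  - intros; apply continuous_gamma_density.
  - intros v _. split; [auto_derive; auto; ring |].
    apply continuous_const.
Qed.

(** The truncated integrals at s = 1 increase to the limit Gamma(nu); for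
    general s the translated interval is squeezed between two symmetric
    ones. *)
Lemma gamma_integral (nu : R) : 0 < nu ->
  exists Gam, 0 < Gam /\
    forall s, 0 < s -> is_lim_seq (gamma_cut nu s) (Gam * / Rpower s nu).
Proof.
  intros Hnu.
  assert (Hincr : forall n, gamma_cut nu 1 n <= gamma_cut nu 1 (S n)).
  { intros n. assert (Hn := pos_INR n).
    apply RInt_gamma_density_incl; rewrite ?S_INR; lra. }
  destruct (ex_finite_lim_seq_incr (gamma_cut nu 1) _ Hincr
    (fun n => gamma_cut_bounded nu n Hnu)) as [Gam HG].
  exists Gam. split.
  - apply Rlt_le_trans with (gamma_cut nu 1 1).
    + apply RInt_gt_0; [simpl; lra | |].
      * intros; apply exp_pos.
      * intros; apply continuous_gamma_density.
    + now apply is_lim_seq_incr_compare.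
  - intros s Hs.
    destruct (nfloor_ex (Rabs (ln s)) (Rabs_pos _)) as [m0 Hm0].
    set (m := S m0).
    assert (Hm : Rabs (ln s) <= INR m) by (unfold m; rewrite S_INR; lra).
    apply Rabs_le_between in Hm.
    apply is_lim_seq_incr_n with m.
    replace (Finite (Gam * / Rpower s nu)) with (Rbar_mult (/ Rpower s nu) Gam)
      by (simpl; f_equal; ring).
    apply (is_lim_seq_ext (fun n => / Rpower s nu *
      RInt (gamma_density nu 1) (- INR (n + m) + ln s) (INR (n + m) + ln s))).
    { intros n. symmetry. now apply gamma_cut_scale. }
    apply is_lim_seq_scal_l.
    apply (is_lim_seq_le_le (gamma_cut nu 1) _ (fun n => gamma_cut nu 1 (n + (m + m)))).
    + intros n. assert (Hn := pos_INR n). rewrite plus_INR.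
      split; apply RInt_gamma_density_incl; rewrite ?plus_INR; lra.
    + exact HG.
    + now apply (is_lim_seq_incr_n (gamma_cut nu 1) (m + m) Gam).
Qed.

Lemma is_lim_seq_exp_opp_INR : is_lim_seq (fun n => exp (- INR n)) 0.
Proof.
  apply (is_lim_comp_seq exp (fun n => - INR n) m_infty 0 is_lim_exp_m).
  - exists 0%nat. intros; discriminate.
  - change m_infty with (Rbar_opp p_infty).
    apply (is_lim_seq_opp INR p_infty), is_lim_seq_INR.
Qed.

(** Integration by parts; the boundary term is exponentially small. *)
Lemma gamma_cut_succ (nu : R) (n : nat) : 0 < nu ->
  nu * gamma_cut nu 1 n - exp ((nu + 1) ^ 2) * exp (- INR n)
    <= gamma_cut (nu + 1) 1 n.
Proof.
  intros Hnu. assert (Hn := pos_INR n).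
  assert (D : is_RInt (fun v => nu * gamma_density nu 1 v - gamma_density (nu + 1) 1 v)
    (- INR n) (INR n)
    (minus (gamma_density nu 1 (INR n)) (gamma_density nu 1 (- INR n)))).
  { apply (is_RInt_derive (gamma_density nu 1)); intros v _.
    - unfold gamma_density. auto_derive; [auto |].
      replace ((nu + 1) * v - 1 * exp v) with (v + (nu * v - 1 * exp v)) by ring.
      rewrite (exp_plus v). unfold Rminus. ring.
    - apply (continuous_minus (V := R_NormedModule)).
      + apply (continuous_scal_r nu (gamma_density nu 1)).
        apply continuous_gamma_density.
      + apply continuous_gamma_density. }
  assert (I : is_RInt (fun v => nu * gamma_density nu 1 v - gamma_density (nu + 1) 1 v)
    (- INR n) (INR n) (nu * gamma_cut nu 1 n - gamma_cut (nu + 1) 1 n)).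
  { apply (is_RInt_minus (V := R_NormedModule)).
    - apply (is_RInt_scal (V := R_NormedModule)).
      apply (RInt_correct (V := R_CompleteNormedModule)), ex_RInt_gamma_density.
    - apply (RInt_correct (V := R_CompleteNormedModule)), ex_RInt_gamma_density. }
  apply (is_RInt_unique (V := R_CompleteNormedModule)) in I.
  apply (is_RInt_unique (V := R_CompleteNormedModule)) in D.
  rewrite D in I.
  unfold minus, plus, opp in I; simpl in I.
  assert (P := exp_pos (nu * - INR n - 1 * exp (- INR n))).
  fold (gamma_density nu 1 (- INR n)) in P.
  assert (U : gamma_density nu 1 (INR n) <= exp ((nu + 1) ^ 2) * exp (- INR n)).
  { unfold gamma_density. rewrite <- exp_plus. apply exp_le_exp.
    assert (Hq := sqr_le_exp (INR n) Hn).
    assert (Hs := pow2_ge_0 (INR n / 2 - (nu + 1))). lra. }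
  lra.
Qed.

Lemma gamma_cut_sum_le (w b : nat -> R) (nu s : R) (N n : nat) :
  (forall x, 0 < x ->
     sum_n (fun k => w k * (x * exp (- b k * x))) N <= exp (- s * x)) ->
  sum_n (fun k => w k * gamma_cut (nu + 1) (b k) n) N <= gamma_cut nu s n.
Proof.
  intros H. assert (Hn := pos_INR n).
  assert (I : is_RInt
    (fun v => sum_n (fun k => w k * gamma_density (nu + 1) (b k) v) N)
    (- INR n) (INR n)
    (sum_n (fun k => w k * gamma_cut (nu + 1) (b k) n) N)).
  { clear H. assert (T : forall k, is_RInt (fun v => w k * gamma_density (nu + 1) (b k) v)
      (- INR n) (INR n) (w k * gamma_cut (nu + 1) (b k) n)).
    { intros k. apply (is_RInt_scal (V := R_NormedModule)).
      apply (RInt_correct (V := R_CompleteNormedModule)), ex_RInt_gamma_density. }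
    induction N as [|N IH].
    - rewrite sum_O. apply (is_RInt_ext (fun v => w 0%nat * gamma_density (nu + 1) (b 0%nat) v)).
      + intros v _. now rewrite sum_O.
      + apply T.
    - rewrite sum_Sn. apply (is_RInt_ext
        (fun v => plus (sum_n (fun k => w k * gamma_density (nu + 1) (b k) v) N)
           (w (S N) * gamma_density (nu + 1) (b (S N)) v))).
      + intros v _. now rewrite sum_Sn.
      + apply (is_RInt_plus (V := R_NormedModule)); [exact IH | apply T]. }
  rewrite <- (is_RInt_unique _ _ _ _ I). apply RInt_le.
  - lra.
  - eexists; exact I.
  - apply ex_RInt_gamma_density.
  - intros v _. specialize (H (exp v) (exp_pos v)).
    apply (Rmult_le_compat_l (exp (nu * v))) in H; [| apply Rlt_le, exp_pos].
    replace (gamma_density nu s v) with (exp (nu * v) * exp (- s * exp v)).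
    2:{ unfold gamma_density. rewrite <- exp_plus. f_equal. ring. }
    refine (Rle_trans _ _ _ _ H). apply Req_le.
    rewrite <- (sum_n_mult_l (K := R_Ring)).
    apply sum_n_ext. intros k. unfold mult; simpl. unfold gamma_density.
    replace ((nu + 1) * v - b k * exp v) with (nu * v + (v + - b k * exp v)) by ring.
    rewrite !exp_plus. ring.
Qed.

(** Integrating the hypothesis against x^(nu-1) gives
    Gamma(nu + 1) sum w_k b_k^(- nu - 1) <= Gamma(nu) s^(- nu), and
    Gamma(nu + 1) = nu Gamma(nu). *)
Lemma power_sum_le_of_exp_sum_le (w b : nat -> R) (nu s : R) (N : nat) :
  0 < nu -> 0 < s -> (forall k, 0 <= w k) -> (forall k, 0 < b k) ->
  (forall x, 0 < x ->
     sum_n (fun k => w k * (x * exp (- b k * x))) N <= exp (- s * x)) ->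
  sum_n (fun k => w k * / Rpower (b k) (nu + 1)) N <= / nu * / Rpower s nu.
Proof.
  intros Hnu Hs Hw Hb H.
  destruct (gamma_integral nu Hnu) as [G [HG LG]].
  destruct (gamma_integral (nu + 1) ltac:(lra)) as [G' [HG' LG']].
  assert (Hrec : nu * G <= G').
  { assert (L1 := LG 1 Rlt_0_1). assert (L1' := LG' 1 Rlt_0_1).
    unfold Rpower in L1, L1'.
    rewrite ln_1, Rmult_0_r, exp_0, Rinv_1, Rmult_1_r in L1, L1'.
    apply (is_lim_seq_le
      (fun n => nu * gamma_cut nu 1 n - exp ((nu + 1) ^ 2) * exp (- INR n))
      (gamma_cut (nu + 1) 1) (nu * G) G'); [| | exact L1'].
    - intros n. now apply gamma_cut_succ.
    - replace (nu * G) with (nu * G - exp ((nu + 1) ^ 2) * 0) by ring.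
      apply is_lim_seq_minus'.
      + apply (is_lim_seq_scal_l _ nu G), L1.
      + apply (is_lim_seq_scal_l _ (exp ((nu + 1) ^ 2)) 0), is_lim_seq_exp_opp_INR. }
  assert (Hlim : sum_n (fun k => w k * (G' * / Rpower (b k) (nu + 1))) N
                 <= G * / Rpower s nu).
  { apply (is_lim_seq_le
      (fun n => sum_n (fun k => w k * gamma_cut (nu + 1) (b k) n) N)
      (gamma_cut nu s)
      (sum_n (fun k => w k * (G' * / Rpower (b k) (nu + 1))) N)
      (G * / Rpower s nu)).
    - intros n. now apply gamma_cut_sum_le.
    - apply is_lim_seq_sum_n. intros k.
      apply (is_lim_seq_scal_l _ (w k) (G' * / Rpower (b k) (nu + 1))), LG', Hb.
    - now apply LG. }
  assert (E : sum_n (fun k => w k * (G' * / Rpower (b k) (nu + 1))) N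
            = G' * sum_n (fun k => w k * / Rpower (b k) (nu + 1)) N).
  { rewrite <- (sum_n_mult_l (K := R_Ring)). apply sum_n_ext. intros k.
    unfold mult; simpl. ring. }
  rewrite E in Hlim.
  assert (P : 0 < / Rpower s nu) by apply Rinv_0_lt_compat, Rpower_pos.
  apply Rmult_le_reg_l with G'; [assumption |].
  apply Rle_trans with (1 := Hlim).
  replace (G * / Rpower s nu) with (nu * G * (/ nu * / Rpower s nu))
    by (field; split; [apply Rgt_not_eq, Rpower_pos | lra]).
  apply Rmult_le_compat_r; [| assumption].
  apply Rmult_le_pos; [apply Rlt_le, Rinv_0_lt_compat |]; lra.
Qed.

Lemma power_sum_le_of_phi_le (p u nu T : R) :
  0 <= u -> 0 < nu -> 0 <= T -> 0 < p + T ->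
  (forall x, 0 < x -> phi u x <= exp (- p * x)) ->
  power_sum nu T u <= / nu * / Rpower (p + T) nu.
Proof.
  intros Hu Hnu HT HpT Hphi.
  apply Series_le_of_partial_sums; [now apply ex_series_power |]. intros N.
  apply (power_sum_le_of_exp_sum_le (fun k => 2 * node u k)
    (fun k => node u k ^ 2 + T)); [assumption .. | | |].
  - intros k. generalize (node_lower u k); lra.
  - intros k. generalize (node_lower u k); nra.
  - intros x Hx. specialize (Hphi x Hx). rewrite phi_exp_sum in Hphi.
    replace (exp (- (p + T) * x)) with (exp (- T * x) * exp (- p * x))
      by (rewrite <- exp_plus; f_equal; ring).
    apply Rle_trans with (exp (- T * x)
      * sum_n (quad_term (fun z => x * exp (- z * x)) u) N).
    + apply Req_le. rewrite <- (sum_n_mult_l (K := R_Ring)). apply sum_n_ext.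
      intros k. unfold quad_term.
      replace (- (node u k ^ 2 + T) * x) with (- T * x + - node u k ^ 2 * x) by ring.
      rewrite exp_plus. unfold mult; simpl. ring.
    + apply Rmult_le_compat_l; [apply Rlt_le, exp_pos |].
      apply Rle_trans with (2 := Hphi). apply sum_n_le_Series.
      * now apply ex_series_exp.
      * intros k. apply (quad_term_nonneg _ _ _ 0 u Hu (convex_density_exp x 0 Hx)).
        nra.
Qed.

(** * Comparison of p with f_mu *)

(** This inverts the definition of [f_mu]: f_mu + t^2 is the base whose
    power gives the value of the sum. *)
Lemma f_mu_correct (mu t u : R) : 0 <= u -> 0 < mu ->
  0 < f_mu mu u t + t ^ 2 /\
  power_sum mu (t ^ 2) u = / mu * / Rpower (f_mu mu u t + t ^ 2) mu.
Proof.
  intros Hu Hmu.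
  assert (HS := power_sum_pos mu (t ^ 2) u Hu Hmu (pow2_ge_0 t)).
  unfold f_mu. rewrite S_mu_power_sum.
  set (K := power_sum mu (t ^ 2) u) in *.
  replace (Rpower (mu * K) (- (1 / mu)) - t ^ 2 + t ^ 2)
    with (Rpower (mu * K) (- (1 / mu))) by ring.
  split; [apply Rpower_pos |].
  rewrite Rpower_mult. replace (- (1 / mu) * mu) with (- (1)) by (field; lra).
  rewrite Rpower_Ropp, Rpower_1 by (apply Rmult_lt_0_compat; lra).
  field; lra.
Qed.

Lemma inv_Rpower_le_iff (c y z : R) : 0 < c -> 0 < y -> 0 < z ->
  / c * / Rpower y c <= / c * / Rpower z c <-> z <= y.
Proof.
  intros Hc Hy Hz. assert (Hi : 0 < / c) by now apply Rinv_0_lt_compat.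
  split; intros H.
  - destruct (Rle_lt_dec z y) as [| Hlt]; [assumption | exfalso].
    assert (E := Rlt_Rpower_l y z c Hc ltac:(lra)).
    apply Rinv_lt_contravar in E;
      [| apply Rmult_lt_0_compat; apply Rpower_pos].
    apply (Rmult_lt_compat_l (/ c)) in E; lra.
  - apply Rmult_le_compat_l; [lra |]. apply inv_Rpower_antitone; lra.
Qed.

Lemma le_f_mu_iff (p mu t u : R) : 0 <= u -> 0 < mu -> 0 < p + t ^ 2 ->
  p <= f_mu mu u t <->
  power_sum mu (t ^ 2) u <= / mu * / Rpower (p + t ^ 2) mu.
Proof.
  intros Hu Hmu Hp. destruct (f_mu_correct mu t u Hu Hmu) as [Hf ->].
  rewrite inv_Rpower_le_iff by assumption. lra.
Qed.

Lemma f_mu_le_iff (p mu t u : R) : 0 <= u -> 0 < mu -> 0 < p + t ^ 2 ->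
  f_mu mu u t <= p <->
  / mu * / Rpower (p + t ^ 2) mu <= power_sum mu (t ^ 2) u.
Proof.
  intros Hu Hmu Hp. destruct (f_mu_correct mu t u Hu Hmu) as [Hf ->].
  rewrite inv_Rpower_le_iff by assumption. lra.
Qed.

(** * Necessity of p >= (1 + u)^2 *)

(** Exponential growth beats linear growth; this rules out too small values
    of p below. *)
Lemma exp_growth (d C : R) :
  (forall n, exp (d * INR n) <= C * (1 + INR n)) -> d <= 0.
Proof.
  intros H. destruct (Rle_lt_dec d 0) as [| Hd]; [assumption | exfalso].
  assert (HC : 1 <= C).
  { specialize (H 0%nat). simpl in H. rewrite Rmult_0_r, exp_0 in H. lra. }
  destruct (INR_unbounded (1 + 8 * C / d ^ 2)) as [n Hn].
  assert (Hd2 : 0 < d ^ 2) by now apply pow_lt.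
  assert (0 < 8 * C / d ^ 2) by (apply Rdiv_lt_0_compat; lra).
  assert (E := sqr_le_exp (d * INR n) ltac:(nra)). specialize (H n).
  assert (Hm : 8 * C / d ^ 2 * d ^ 2 < INR n * d ^ 2)
    by (apply Rmult_lt_compat_r; lra).
  replace (8 * C / d ^ 2 * d ^ 2) with (8 * C) in Hm by (field; lra).
  assert (INR n * (8 * C) < INR n * (INR n * d ^ 2))
    by (apply Rmult_lt_compat_l; lra).
  nra.
Qed.

Lemma power_sum_shift_le (mu u : R) (k : nat) : 0 <= u -> 0 < mu ->
  power_sum (mu + INR k) 1 u <= / Rpower ((1 + u) ^ 2 + 1) (INR k) * power_sum mu 1 u.
Proof.
  intros Hu Hmu. assert (Hk := pos_INR k).
  unfold power_sum. rewrite <- Series_scal_l. apply Series_mono.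
  - apply ex_series_power; lra.
  - apply (ex_series_scal_l (V := R_NormedModule)), ex_series_power; lra.
  - intros j. unfold quad_term. assert (Hn := node_lower u j).
    set (a := node u j) in *.
    replace (mu + INR k + 1) with (INR k + (mu + 1)) by ring.
    rewrite Rpower_plus, Rinv_mult.
    assert (E : / Rpower (a ^ 2 + 1) (INR k) <= / Rpower ((1 + u) ^ 2 + 1) (INR k))
      by (apply inv_Rpower_antitone; nra).
    assert (P : 0 < / Rpower (a ^ 2 + 1) (mu + 1))
      by apply Rinv_0_lt_compat, Rpower_pos.
    replace (/ Rpower ((1 + u) ^ 2 + 1) (INR k) * (2 * a * / Rpower (a ^ 2 + 1) (mu + 1)))
      with (2 * a * (/ Rpower ((1 + u) ^ 2 + 1) (INR k) * / Rpower (a ^ 2 + 1) (mu + 1)))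
      by ring.
    apply Rmult_le_compat_l; [lra |]. apply Rmult_le_compat_r; lra.
Qed.

Lemma ge_sqr_of_power_sum_ge (p u mu : R) : 0 <= p -> 0 <= u -> 0 < mu ->
  (forall k : nat, / (mu + INR k) * / Rpower (p + 1) (mu + INR k)
                   <= power_sum (mu + INR k) 1 u) ->
  (1 + u) ^ 2 <= p.
Proof.
  intros Hp Hu Hmu H.
  assert (Hd : ln ((1 + u) ^ 2 + 1) - ln (p + 1) <= 0).
  { assert (HK := power_sum_pos mu 1 u Hu Hmu Rle_0_1).
    set (K := power_sum mu 1 u) in *.
    apply (exp_growth _ ((mu + 1) * (Rpower (p + 1) mu * K))). intros n.
    assert (Hn := pos_INR n). specialize (H n).
    assert (E := power_sum_shift_le mu u n Hu Hmu). fold K in E.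
    assert (E2 := Rle_trans _ _ _ H E). clear H E.
    rewrite Rpower_plus, Rinv_mult in E2.
    assert (P1 := Rpower_pos (p + 1) mu).
    assert (P2 := Rpower_pos (p + 1) (INR n)).
    assert (P3 := Rpower_pos ((1 + u) ^ 2 + 1) (INR n)).
    replace (exp ((ln ((1 + u) ^ 2 + 1) - ln (p + 1)) * INR n))
      with (Rpower ((1 + u) ^ 2 + 1) (INR n) * / Rpower (p + 1) (INR n)).
    2:{ unfold Rpower. rewrite <- exp_Ropp, <- exp_plus. f_equal. ring. }
    set (X := Rpower (p + 1) mu) in *. set (Y := Rpower (p + 1) (INR n)) in *.
    set (Z := Rpower ((1 + u) ^ 2 + 1) (INR n)) in *.
    apply (Rmult_le_compat_l ((mu + INR n) * X * Z)) in E2.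
    2:{ repeat apply Rmult_le_pos; lra. }
    replace ((mu + INR n) * X * Z * (/ (mu + INR n) * (/ X * / Y)))
      with (Z * / Y) in E2 by (field; lra).
    replace ((mu + INR n) * X * Z * (/ Z * K))
      with ((mu + INR n) * (X * K)) in E2 by (field; lra).
    apply Rle_trans with (1 := E2).
    replace ((mu + 1) * (X * K) * (1 + INR n))
      with ((mu + 1) * (1 + INR n) * (X * K)) by ring.
    apply Rmult_le_compat_r; [apply Rmult_le_pos; lra | nra]. }
  destruct (Rle_lt_dec ((1 + u) ^ 2) p) as [| Hlt]; [assumption | exfalso].
  assert (E := ln_increasing (p + 1) ((1 + u) ^ 2 + 1) ltac:(lra) ltac:(lra)).
  lra.
Qed.

Lemma phi_decay (u : R) (n : nat) : 0 <= u ->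
  phi u (1 + INR n) <= (1 + INR n) * exp (- (1 + u) ^ 2 * INR n) * phi u 1.
Proof.
  intros Hu. assert (Hn := pos_INR n). rewrite !phi_exp_sum.
  unfold exp_sum. rewrite <- Series_scal_l. apply Series_mono.
  - apply ex_series_exp; lra.
  - apply (ex_series_scal_l (V := R_NormedModule)), ex_series_exp; lra.
  - intros j. unfold quad_term. assert (Hj := node_lower u j).
    set (a := node u j) in *.
    replace (- a ^ 2 * (1 + INR n)) with (- a ^ 2 * INR n + - a ^ 2 * 1) by ring.
    rewrite exp_plus.
    assert (E : exp (- a ^ 2 * INR n) <= exp (- (1 + u) ^ 2 * INR n)).
    { apply exp_le_exp. apply Rmult_le_compat_r; [lra | nra]. }
    replace ((1 + INR n) * exp (- (1 + u) ^ 2 * INR n) * (2 * a * (1 * exp (- a ^ 2 * 1))))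
      with (2 * a * (1 + INR n) * (exp (- (1 + u) ^ 2 * INR n) * exp (- a ^ 2 * 1))) by ring.
    rewrite <- Rmult_assoc.
    apply Rmult_le_compat_l; [apply Rmult_le_pos; lra |].
    apply Rmult_le_compat_r; [apply Rlt_le, exp_pos | exact E].
Qed.

Lemma le_opp_sqr_of_phi_ge (b u : R) : 0 <= u ->
  (forall x, 0 < x -> exp (b * x) <= phi u x) -> b <= - (1 + u) ^ 2.
Proof.
  intros Hu H. enough (b + (1 + u) ^ 2 <= 0) by lra.
  apply (exp_growth _ (exp (- b) * phi u 1)). intros n.
  assert (Hn := pos_INR n).
  assert (E := Rle_trans _ _ _ (H (1 + INR n) ltac:(lra)) (phi_decay u n Hu)).
  apply (Rmult_le_compat_l (exp (- b) * exp ((1 + u) ^ 2 * INR n))) in E.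
  2:{ apply Rlt_le, Rmult_lt_0_compat; apply exp_pos. }
  rewrite <- !exp_plus in E.
  replace (- b + (1 + u) ^ 2 * INR n + b * (1 + INR n))
    with ((b + (1 + u) ^ 2) * INR n) in E by ring.
  apply Rle_trans with (1 := E). apply Req_le.
  replace (exp (- b + (1 + u) ^ 2 * INR n))
    with (exp (- b) * / exp (- (1 + u) ^ 2 * INR n)).
  - field. apply Rgt_not_eq, exp_pos.
  - rewrite <- exp_Ropp, <- exp_plus. f_equal. ring.
Qed.

(** * The bound q + 1/6 *)

Lemma Rpower_2 (z : R) : 0 < z -> Rpower z (1 + 1) = z ^ 2.
Proof. intros Hz. rewrite Rpower_succ, Rpower_1 by assumption. ring. Qed.

Lemma Rpower_4 (z : R) : 0 < z -> Rpower z (3 + 1) = z ^ 4.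
Proof.
  intros Hz. rewrite <- (Rpower_pow 4) by assumption. f_equal. simpl. ring.
Qed.

Lemma Rpower_3 (z : R) : 0 < z -> Rpower z 3 = z ^ 3.
Proof.
  intros Hz. rewrite <- (Rpower_pow 3) by assumption. f_equal. simpl. ring.
Qed.

(** With Y = a^2 + T + 1/2 the telescoping difference is 2 a / X, where
    X = Y^2 - a^2 exceeds (a^2 + T)^2 by T + 1/4 only.  The shift 1/2 is
    the one for which this excess does not depend on a; expanding
    1 / (X - e) to first order in e = T + 1/4 gives the correction term. *)
Lemma telescoping_term_le (a T : R) : 1 <= a -> 0 <= T ->
  / (a * (a - 1) + (T + 1 / 2)) - / ((a + 1) * a + (T + 1 / 2))
    + (T + 1 / 4) * (2 * a * / (a ^ 2 + (T + 1 / 2)) ^ 4)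
  <= 2 * a * / (a ^ 2 + T) ^ 2.
Proof.
  intros Ha HT.
  set (e := T + 1 / 4). set (Y := a ^ 2 + (T + 1 / 2)).
  set (X := Y ^ 2 - a ^ 2).
  assert (HY : a < Y) by (unfold Y; nra).
  assert (HX : 0 < X) by (unfold X; nra).
  assert (HXe : (a ^ 2 + T) ^ 2 = X - e) by (unfold X, Y, e; field).
  assert (HXe0 : 0 < X - e) by (rewrite <- HXe; apply pow_lt; nra).
  assert (He : 0 < e) by (unfold e; lra).
  rewrite HXe.
  replace (/ (a * (a - 1) + (T + 1 / 2)) - / ((a + 1) * a + (T + 1 / 2)))
    with (2 * a * / X).
  2:{ unfold X, Y. field. repeat split; unfold Y in *; nra. }
  assert (E1 : / Y ^ 4 <= / X ^ 2).
  { apply Rinv_le_contravar; [apply pow_lt, HX |].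
    replace (Y ^ 4) with ((Y ^ 2) ^ 2) by ring.
    apply pow_incr. unfold X. nra. }
  assert (E2 : / X + e * / X ^ 2 <= / (X - e)).
  { apply Rminus_le_0.
    replace (/ (X - e) - (/ X + e * / X ^ 2)) with (e ^ 2 / (X ^ 2 * (X - e)))
      by (field; lra).
    apply Rlt_le, Rdiv_lt_0_compat; [nra |].
    apply Rmult_lt_0_compat; [apply pow_lt|]; assumption. }
  assert (E3 : e * / Y ^ 4 <= e * / X ^ 2) by (apply Rmult_le_compat_l; lra).
  replace (2 * a * / X + e * (2 * a * / Y ^ 4))
    with (2 * a * (/ X + e * / Y ^ 4)) by ring.
  apply Rmult_le_compat_l; lra.
Qed.

(** The correction term is again a power sum, with exponent 3, and is
    bounded below by the trapezoid inequality.  As T tends to infinity it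
    contributes 1 / (3 T^2), which turns the constant q + 1/2 of the
    telescoping part into q + 1/2 - 1/3 = q + 1/6. *)
Lemma power_sum_1_ge (u T : R) : 0 <= u -> 0 <= T ->
  / (u ^ 2 + u + T + 1 / 2) + (T + 1 / 4) * (/ 3 * / ((1 + u) ^ 2 + T + 1 / 2) ^ 3)
    <= power_sum 1 T u.
Proof.
  intros Hu HT.
  assert (H3 := power_sum_ge 3 (T + 1 / 2) u Hu ltac:(lra) ltac:(lra)).
  rewrite Rpower_3 in H3 by nra.
  replace ((1 + u) ^ 2 + (T + 1 / 2)) with ((1 + u) ^ 2 + T + 1 / 2) in H3 by ring.
  apply (Rmult_le_compat_l (T + 1 / 4)) in H3; [| lra].
  assert (X1 := ex_series_power 1 T u Hu Rlt_0_1 HT).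
  assert (X3 := ex_series_power 3 (T + 1 / 2) u Hu ltac:(lra) ltac:(lra)).
  set (V := fun k => / (node u k * (node u k - 1) + (T + 1 / 2))).
  enough (H : V 0%nat <= power_sum 1 T u - (T + 1 / 4) * power_sum 3 (T + 1 / 2) u).
  { unfold V in H. rewrite node_0 in H.
    replace ((1 + u) * (1 + u - 1) + (T + 1 / 2)) with (u ^ 2 + u + T + 1 / 2) in H
      by ring. lra. }
  assert (X3' := ex_series_scal_l (V := R_NormedModule) (T + 1 / 4) _ X3).
  unfold power_sum.
  rewrite <- Series_scal_l, <- Series_minus by assumption.
  apply telescope_le_Series.
  - now apply (ex_series_minus (V := R_NormedModule)).
  - unfold V. change (Finite 0) with (Rbar_inv p_infty).
    apply is_lim_seq_inv; [| discriminate].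
    apply (is_lim_seq_le_p_loc INR); [| apply is_lim_seq_INR].
    exists 0%nat. intros k _. rewrite <- node_eq. assert (Hk := pos_INR k). nra.
  - intros k. unfold V, quad_term. rewrite node_S.
    assert (Hn := node_lower u k). set (a := node u k) in *.
    rewrite Rpower_2, Rpower_4 by nra.
    replace ((a + 1) * (a + 1 - 1)) with ((a + 1) * a) by ring.
    assert (E := telescoping_term_le a T ltac:(lra) HT). lra.
Qed.

(** For p > q + 1/6 the two bounds on the sum contradict each other for large
    T.  Multiplied out, they give y^3 - 3 al y^2 <= 3 d y^3 in the variable
    y = T + al, where d = q + 1/2 - p < 1/3. *)
Lemma le_q_plus_sixth (p u : R) : 0 <= p -> 0 <= u ->
  (forall T, 0 < T -> power_sum 1 T u <= / (p + T)) ->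
  p <= u ^ 2 + u + 1 / 6.
Proof.
  intros Hp Hu H.
  destruct (Rle_lt_dec p (u ^ 2 + u + 1 / 6)) as [| Hlt]; [assumption | exfalso].
  set (d := u ^ 2 + u + 1 / 2 - p).
  assert (Hd : 0 < 1 - 3 * d) by (unfold d; lra).
  set (al := (1 + u) ^ 2 + 1 / 2).
  assert (Hal : 1 <= al) by (unfold al; nra).
  (* Large enough for T = y - al > 0 and for y (1 - 3 d) > 3 al. *)
  set (y := 3 * al / (1 - 3 * d) + 1 + al).
  assert (Hq : 0 < 3 * al / (1 - 3 * d)) by (apply Rdiv_lt_0_compat; lra).
  assert (Hy : al + 1 < y) by (unfold y; lra).
  assert (Hyd : 3 * al < y * (1 - 3 * d)).
  { unfold y.
    replace ((3 * al / (1 - 3 * d) + 1 + al) * (1 - 3 * d))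
      with (3 * al + (1 + al) * (1 - 3 * d)) by (field; lra). nra. }
  set (T := y - al).
  assert (HT : 0 < T) by (unfold T; lra).
  assert (E := Rle_trans _ _ _ (power_sum_1_ge u T Hu (Rlt_le _ _ HT)) (H T HT)).
  replace ((1 + u) ^ 2 + T + 1 / 2) with y in E by (unfold T, al; ring).
  set (Q := u ^ 2 + u + T + 1 / 2) in *.
  assert (HQ : T < Q) by (unfold Q; nra).
  assert (E1 : (T + 1 / 4) * (/ 3 * / y ^ 3) <= d / ((p + T) * Q)).
  { replace (d / ((p + T) * Q)) with (/ (p + T) - / Q); [lra |].
    replace d with (Q - (p + T)) by (unfold d, Q; ring). field. lra. }
  assert (HPQ : 0 < (p + T) * Q) by (apply Rmult_lt_0_compat; lra).
  assert (Hy3 : 0 < y ^ 3) by (apply pow_lt; lra).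
  apply (Rmult_le_compat_r (3 * y ^ 3 * ((p + T) * Q))) in E1.
  2:{ apply Rmult_le_pos; lra. }
  replace ((T + 1 / 4) * (/ 3 * / y ^ 3) * (3 * y ^ 3 * ((p + T) * Q)))
    with ((T + 1 / 4) * ((p + T) * Q)) in E1 by (field; lra).
  replace (d / ((p + T) * Q) * (3 * y ^ 3 * ((p + T) * Q)))
    with (3 * d * y ^ 3) in E1 by (field; lra).
  assert (E2 : T ^ 3 <= (T + 1 / 4) * ((p + T) * Q)).
  { replace (T ^ 3) with (T * (T * T)) by ring.
    apply Rmult_le_compat; [lra | nra | lra |].
    apply Rmult_le_compat; lra. }
  assert (E3 : y ^ 3 - 3 * al * y ^ 2 <= T ^ 3).
  { unfold T. replace ((y - al) ^ 3)
      with (y ^ 3 - 3 * al * y ^ 2 + al ^ 2 * (3 * y - al)) by ring.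
    assert (0 <= al ^ 2 * (3 * y - al)) by (apply Rmult_le_pos; nra). lra. }
  assert (E4 : y ^ 2 * (y * (1 - 3 * d)) <= y ^ 2 * (3 * al)) by nra.
  apply Rmult_le_reg_l in E4; [lra | nra].
Qed.

(** * The strict bound by q *)

Lemma cube_le_sinh (y : R) : 0 <= y -> y ^ 3 / 3 <= exp y - exp (- y) - 2 * y.
Proof.
  intros Hy.
  assert (step : forall f df : R -> R, (forall z, is_derive f z (df z)) ->
    f 0 = 0 -> (forall z, 0 <= z -> 0 <= df z) -> forall z, 0 <= z -> 0 <= f z).
  { intros f df Hd H0 Hp z Hz. rewrite <- H0.
    apply nondecreasing_of_derive with df; [assumption | auto |].
    intros x Hx. apply Hp; lra. }
  assert (H1 : forall z, 0 <= z -> 0 <= exp z + exp (- z) - 2).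
  { apply (step _ (fun z => exp z - exp (- z))).
    - intros z. auto_derive; [auto | ring].
    - rewrite Ropp_0, exp_0. ring.
    - intros z Hz. assert (exp (- z) <= exp z) by (apply exp_le_exp; lra). lra. }
  assert (H2 : forall z, 0 <= z -> 0 <= exp z - exp (- z) - 2 * z).
  { apply (step _ (fun z => exp z + exp (- z) - 2)); [| | assumption].
    - intros z. auto_derive; [auto | ring].
    - rewrite Ropp_0, exp_0. ring. }
  assert (H3 : forall z, 0 <= z -> 0 <= exp z + exp (- z) - 2 - z ^ 2).
  { apply (step _ (fun z => exp z - exp (- z) - 2 * z)); [| | assumption].
    - intros z. auto_derive; [auto | ring].
    - rewrite Ropp_0, exp_0. ring. }
  enough (0 <= exp y - exp (- y) - 2 * y - y ^ 3 / 3) by lra.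
  apply (step (fun y => exp y - exp (- y) - 2 * y - y ^ 3 / 3)
    (fun z => exp z + exp (- z) - 2 - z ^ 2)); [| | assumption | assumption].
  - intros z. auto_derive; [auto | field].
  - rewrite Ropp_0, exp_0. field.
Qed.

Lemma phi_upper (u x : R) : 0 <= u -> 0 < x -> phi u x <= exp (- (u ^ 2 + u) * x).
Proof.
  intros Hu Hx. rewrite phi_exp_sum.
  apply Series_le_of_partial_sums; [now apply ex_series_exp |]. intros n.
  apply (sum_quad_le (fun z => exp (- z * x)) _ _ 0 u Hu (convex_density_exp x 0 Hx)).
  nra.
Qed.

(** The midpoint inequality at the node a is here
    2 a x <= exp(a x) - exp(- a x), up to the factor exp(- a^2 x), and its
    loss is at least (a x)^3 / 3.  Since w exp(- w) >= exp(- w) - exp(- 2 w)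
    for w = a^2 x, the losses add up to a combination of phi(x) and
    phi(2 x). *)
Lemma phi_excess (u x : R) : 0 <= u -> 0 < x ->
  phi u x + x / 6 * (phi u x - phi u (2 * x) / 2) <= exp (- (u ^ 2 + u) * x).
Proof.
  intros Hu Hx.
  assert (X1 := ex_series_exp x u Hu Hx).
  assert (X2 := ex_series_exp (2 * x) u Hu ltac:(lra)).
  assert (X1' := ex_series_scal_l (V := R_NormedModule) (1 + x / 6) _ X1).
  assert (X2' := ex_series_scal_l (V := R_NormedModule) (x / 12) _ X2).
  rewrite !phi_exp_sum.
  replace (exp_sum x u + x / 6 * (exp_sum x u - exp_sum (2 * x) u / 2))
    with ((1 + x / 6) * exp_sum x u - x / 12 * exp_sum (2 * x) u) by field.
  unfold exp_sum. rewrite <- !Series_scal_l, <- Series_minus by assumption.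
  apply Series_le_of_partial_sums; [now apply (ex_series_minus (V := R_NormedModule)) |].
  intros n. set (V := fun k => exp (- (node u k * (node u k - 1)) * x)).
  apply Rle_trans with (V 0%nat - V (S n)).
  2:{ unfold V at 1. rewrite node_0.
      replace (- ((1 + u) * (1 + u - 1)) * x) with (- (u ^ 2 + u) * x) by ring.
      assert (0 < V (S n)) by apply exp_pos. lra. }
  apply sum_n_le_telescope. intros k. unfold V, quad_term. rewrite node_S.
  assert (Hn := node_lower u k). set (a := node u k) in *.
  replace (- (a * (a - 1)) * x) with (- a ^ 2 * x + a * x) by ring.
  replace (- ((a + 1) * (a + 1 - 1)) * x) with (- a ^ 2 * x + - (a * x)) by ring.
  replace (- a ^ 2 * (2 * x)) with (- a ^ 2 * x + - (a ^ 2 * x)) by ring.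
  rewrite !exp_plus. set (E := exp (- a ^ 2 * x)).
  assert (HE : 0 < E) by apply exp_pos.
  assert (Hax : 0 <= a * x) by nra.
  assert (H1 := cube_le_sinh (a * x) Hax).
  assert (H2 := exp_ineq1_le (- (a ^ 2 * x))).
  assert (H3 : a * x ^ 2 / 3 * (1 - exp (- (a ^ 2 * x))) <= a * x ^ 2 / 3 * (a ^ 2 * x)).
  { apply Rmult_le_compat_l; [nra | lra]. }
  assert (H4 : E * (2 * (a * x) + a * x ^ 2 / 3 * (1 - exp (- (a ^ 2 * x))))
               <= E * (exp (a * x) - exp (- (a * x)))).
  { apply Rmult_le_compat_l; [lra |]. lra. }
  lra.
Qed.

(** For such x the bracket in [phi_excess] is at least 3/4 - 1/2, so the
    total loss is at least x / 24. *)
Lemma phi_le_small (u x : R) : 0 <= u -> 0 < x -> x <= / (4 * (1 + u) ^ 2) ->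
  phi u x <= exp (- (u ^ 2 + u + 1 / 24) * x).
Proof.
  intros Hu Hx Hx0.
  assert (H1 := phi_excess u x Hu Hx).
  assert (H2 := phi_ge u x Hu Hx).
  assert (H3 := phi_upper u (2 * x) Hu ltac:(lra)).
  assert (H4 : exp (- (u ^ 2 + u) * (2 * x)) <= 1).
  { rewrite <- exp_0. apply exp_le_exp.
    assert (0 <= (u ^ 2 + u) * (2 * x)) by (apply Rmult_le_pos; nra). lra. }
  assert (H5 : (1 + u) ^ 2 * x <= 1 / 4).
  { apply (Rmult_le_compat_l ((1 + u) ^ 2)) in Hx0; [| nra].
    replace ((1 + u) ^ 2 * / (4 * (1 + u) ^ 2)) with (1 / 4) in Hx0
      by (field; lra). exact Hx0. }
  assert (H6 := exp_ineq1_le (- (1 + u) ^ 2 * x)).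
  assert (H7 : x / 24 <= x / 6 * (phi u x - phi u (2 * x) / 2)).
  { replace (x / 24) with (x / 6 * (1 / 4)) by field.
    apply Rmult_le_compat_l; lra. }
  replace (- (u ^ 2 + u + 1 / 24) * x) with (- (u ^ 2 + u) * x + - (x / 24)) by field.
  rewrite exp_plus.
  assert (H8 := exp_ineq1_le (- (x / 24))).
  assert (H9 : exp (- (u ^ 2 + u) * x) <= 1).
  { rewrite <- exp_0. apply exp_le_exp.
    assert (0 <= (u ^ 2 + u) * x) by (apply Rmult_le_pos; nra). lra. }
  assert (H10 := exp_pos (- (u ^ 2 + u) * x)).
  set (A := exp (- (u ^ 2 + u) * x)) in *.
  apply Rle_trans with (A * (1 + - (x / 24))).
  - assert (A * (x / 24) <= 1 * (x / 24)) by (apply Rmult_le_compat_r; lra). lra.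
  - apply Rmult_le_compat_l; lra.
Qed.

(** Keep the first term and bound the others, which form phi for the
    parameter u + 1. *)
Lemma phi_first_term (u x : R) : 0 <= u -> 0 < x ->
  phi u x <= exp (- (u ^ 2 + u) * x) *
    (exp (- (2 * ((1 + u) * x))) + 2 * ((1 + u) * x) * exp (- ((1 + u) * x))).
Proof.
  intros Hu Hx.
  assert (E : phi u x = 2 * (1 + u) * (x * exp (- (1 + u) ^ 2 * x)) + phi (u + 1) x).
  { rewrite !phi_exp_sum. unfold exp_sum.
    rewrite Series_incr_1 by now apply ex_series_exp.
    unfold quad_term at 1. rewrite node_0. f_equal.
    apply Series_ext. intros k. unfold quad_term. rewrite node_S.
    replace (node (u + 1) k) with (node u k + 1) by (unfold node; ring).
    reflexivity. }
  rewrite E. assert (H := phi_upper (u + 1) x ltac:(lra) Hx).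
  replace (exp (- ((u + 1) ^ 2 + (u + 1)) * x))
    with (exp (- (u ^ 2 + u) * x) * exp (- (2 * ((1 + u) * x)))) in H
    by (rewrite <- exp_plus; f_equal; ring).
  replace (exp (- (1 + u) ^ 2 * x))
    with (exp (- (u ^ 2 + u) * x) * exp (- ((1 + u) * x)))
    by (rewrite <- exp_plus; f_equal; ring).
  lra.
Qed.

(** The left side is 1 - exp(- y) (exp y - exp(- y) - 2 y), hence less than 1
    on the compact range y0 <= y <= 24; beyond it, the factor
    exp(- y) dominates.  The number 24 makes 1 + 2 y <= (1 + y / 4)^2. *)
Lemma first_term_decay (y0 : R) : 0 < y0 ->
  exists d, 0 < d /\ forall y, y0 <= y ->
    exp (- (2 * y)) + 2 * y * exp (- y) <= exp (- (d * y)).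
Proof.
  intros Hy0.
  assert (He := exp_pos (-24)).
  exists (Rmin (1 / 2) (exp (-24) * y0 ^ 2 / 3)). split.
  { apply Rmin_glb_lt; [lra |]. assert (0 < y0 ^ 2) by now apply pow_lt.
    assert (0 < exp (-24) * y0 ^ 2) by now apply Rmult_lt_0_compat. lra. }
  intros y Hy. set (d := Rmin _ _).
  replace (- (2 * y)) with (- y + - y) by ring. rewrite exp_plus.
  assert (P := exp_pos (- y)).
  destruct (Rle_lt_dec y 24) as [H24 | H24].
  - apply Rle_trans with (exp (- (exp (-24) * y0 ^ 2 / 3 * y))).
    2:{ apply exp_le_exp. assert (d <= exp (-24) * y0 ^ 2 / 3) by apply Rmin_r. nra. }
    apply Rle_trans with (1 + - (exp (-24) * y0 ^ 2 / 3 * y)); [| apply exp_ineq1_le].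
    assert (C := cube_le_sinh y ltac:(lra)).
    assert (E : exp (- y) * exp y = 1).
    { rewrite <- exp_plus, Rplus_opp_l. apply exp_0. }
    assert (E2 : exp (-24) <= exp (- y)) by (apply exp_le_exp; lra).
    apply (Rmult_le_compat_l (exp (- y))) in C; [| lra].
    assert (E3 : exp (-24) * (y0 ^ 2 * y / 3) <= exp (- y) * (y ^ 3 / 3)).
    { assert (y0 ^ 2 <= y ^ 2) by nra.
      apply Rmult_le_compat; [lra | | assumption |].
      - assert (0 <= y0 ^ 2 * y) by (apply Rmult_le_pos; nra). lra.
      - assert (y0 ^ 2 * y <= y ^ 2 * y) by (apply Rmult_le_compat_r; lra).
        lra. }
    nra.
  - apply Rle_trans with (exp (- (1 / 2 * y))).
    2:{ apply exp_le_exp. assert (d <= 1 / 2) by apply Rmin_l. nra. }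
    replace (exp (- (1 / 2 * y))) with (exp (- y) * exp (y / 2))
      by (rewrite <- exp_plus; f_equal; field).
    assert (exp (- y) <= 1) by (rewrite <- exp_0; apply exp_le_exp; lra).
    assert (G : 1 + 2 * y <= exp (y / 2)).
    { replace (exp (y / 2)) with (exp (y / 4) * exp (y / 4))
        by (rewrite <- exp_plus; f_equal; field).
      assert (E := exp_ineq1_le (y / 4)). nra. }
    nra.
Qed.

Lemma phi_le_strict (u : R) : 0 <= u ->
  exists d, 0 < d /\ forall x, 0 < x -> phi u x <= exp (- (u ^ 2 + u + d) * x).
Proof.
  intros Hu. set (x0 := / (4 * (1 + u) ^ 2)).
  assert (Hx0 : 0 < x0) by (apply Rinv_0_lt_compat; nra).
  destruct (first_term_decay x0 Hx0) as [d [Hd H]].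
  exists (Rmin d (1 / 24)). split; [apply Rmin_glb_lt; lra |].
  intros x Hx. set (m := Rmin _ _).
  destruct (Rle_lt_dec x x0) as [Hl | Hl].
  - apply Rle_trans with (1 := phi_le_small u x Hu Hx Hl). apply exp_le_exp.
    assert (m <= 1 / 24) by apply Rmin_r. nra.
  - apply Rle_trans with (1 := phi_first_term u x Hu Hx).
    replace (- (u ^ 2 + u + m) * x) with (- (u ^ 2 + u) * x + - (m * x)) by ring.
    rewrite exp_plus. apply Rmult_le_compat_l; [apply Rlt_le, exp_pos |].
    apply Rle_trans with (1 := H ((1 + u) * x) ltac:(nra)).
    apply exp_le_exp. assert (m <= d) by apply Rmin_l.
    assert (m * x <= d * x) by nra.
    assert (0 <= d * (u * x)) by (repeat apply Rmult_le_pos; lra).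
    lra.
Qed.

(** * Identification of the extremal constants *)

Lemma phi_le_exp_iff (p u x : R) : 0 <= u -> 0 < x ->
  phi u x <= exp (- p * x) <-> ln (phi u x) / x <= - p.
Proof.
  intros Hu Hx. assert (P := phi_pos u x Hu Hx). split; intros H.
  - apply Rle_div_l; [assumption |]. rewrite <- (ln_exp (- p * x)).
    destruct H as [H | ->]; [apply Rlt_le, ln_increasing; assumption | lra].
  - apply Rle_div_l in H; [| assumption].
    rewrite <- (exp_ln (phi u x)) by assumption. now apply exp_le_exp.
Qed.

Lemma exp_le_phi_iff (b u x : R) : 0 <= u -> 0 < x ->
  exp (b * x) <= phi u x <-> b <= ln (phi u x) / x.
Proof.
  intros Hu Hx. assert (P := phi_pos u x Hu Hx). split; intros H.
  - apply Rle_div_r; [assumption |]. rewrite <- (ln_exp (b * x)).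
    destruct H as [H | <-]; [apply Rlt_le, ln_increasing; auto using exp_pos | lra].
  - apply Rle_div_r in H; [| assumption].
    rewrite <- (exp_ln (phi u x)) by assumption. now apply exp_le_exp.
Qed.

Lemma psi_nonneg_of_le_f_mu (p u mu t : R) : 0 <= p -> 0 <= u -> 0 < mu -> 0 < t ->
  p <= f_mu mu u (sqrt t) -> 0 <= psi p u mu t.
Proof.
  intros Hp Hu Hmu Ht H. rewrite psi_power_sum by assumption.
  assert (E : sqrt t ^ 2 = t) by (apply pow2_sqrt; lra).
  apply le_f_mu_iff in H; rewrite ?E in *; lra.
Qed.

Lemma psi_nonneg_of_phi_le (p u : R) : 0 <= p -> 0 <= u ->
  (forall x, 0 < x -> phi u x <= exp (- p * x)) ->
  forall mu t, 0 < mu -> 0 < t -> 0 <= psi p u mu t.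
Proof.
  intros Hp Hu H mu t Hmu Ht. rewrite psi_power_sum by assumption.
  assert (E := power_sum_le_of_phi_le p u mu t Hu Hmu ltac:(lra) ltac:(lra) H). lra.
Qed.

(** The strict upper bound on phi puts the supremum below - q, and the value
    at x = 1 keeps it finite. *)
Lemma phi_rate_sup (u : R) : 0 <= u -> exists P,
  Lub_Rbar (fun y => exists x, 0 < x /\ y = ln (phi u x) / x) = Finite (- P) /\
  (forall p, (forall x, 0 < x -> phi u x <= exp (- p * x)) <-> p <= P) /\
  u ^ 2 + u < P.
Proof.
  intros Hu.
  set (E := fun y => exists x, 0 < x /\ y = ln (phi u x) / x).
  destruct (Lub_Rbar_correct E) as [Hub Hleast].
  assert (Hge : forall p, (forall x, 0 < x -> phi u x <= exp (- p * x)) ->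
    Rbar_le (Lub_Rbar E) (- p)).
  { intros p Hp. apply Hleast. intros y [x [Hx ->]].
    apply phi_le_exp_iff; auto. }
  destruct (phi_le_strict u Hu) as [d [Hd Hstrict]].
  assert (Hs := Hge _ Hstrict).
  assert (H1 : Rbar_le (ln (phi u 1) / 1) (Lub_Rbar E))
    by (apply Hub; exists 1; split; [lra | reflexivity]).
  destruct (Lub_Rbar E) as [l | |]; [| destruct Hs | destruct H1].
  exists (- l). rewrite Ropp_involutive. simpl in Hs.
  split; [reflexivity |]. split; [| lra].
  intros p. split.
  - intros H. specialize (Hge p H). simpl in Hge. lra.
  - intros H x Hx. apply phi_le_exp_iff; [assumption .. |].
    assert (Hx' : Rbar_le (ln (phi u x) / x) l)
      by (apply Hub; exists x; split; [assumption | reflexivity]).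
    simpl in Hx'. lra.
Qed.

(** P is a lower bound of all the f_mu by Euler's integral, and a positive
    lower bound of all the f_mu makes every psi nonnegative, hence does not
    exceed P by Post-Widder inversion. *)
Lemma m_infty_eq (u P : R) : 0 <= u -> 0 < P ->
  (forall p, (forall x, 0 < x -> phi u x <= exp (- p * x)) <-> p <= P) ->
  m_infty_u u = Finite P.
Proof.
  intros Hu HP H. apply Rbar_is_glb_unique. split.
  - intros y [mu [Hmu ->]]. apply Glb_Rbar_correct. intros y [t [Ht ->]]. simpl.
    assert (Ht2 := pow2_ge_0 t).
    apply le_f_mu_iff; [assumption .. | lra |].
    apply power_sum_le_of_phi_le; [assumption .. | lra |].
    apply H. lra.
  - intros b Hb.
    assert (Hbf : forall mu t, 0 < mu -> 0 <= t -> Rbar_le b (f_mu mu u t)).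
    { intros mu t Hmu Ht. apply Rbar_le_trans with (m_mu mu u).
      - apply Hb. now exists mu.
      - apply Glb_Rbar_correct. now exists t. }
    destruct b as [r | |]; [| destruct (Hbf 1 0 Rlt_0_1 (Rle_refl 0)) | exact I].
    simpl. destruct (Rle_lt_dec r 0) as [Hr | Hr]; [lra |].
    apply H. apply (phi_le_of_psi_nonneg r u 1); [lra | assumption | lra |].
    intros k t Ht. assert (Hk := pos_INR k).
    apply psi_nonneg_of_le_f_mu; [lra | assumption | lra | assumption |].
    apply (Hbf (1 + INR k) (sqrt t)); [lra | apply sqrt_pos].
Qed.

(** The value (1 + u)^2 bounds every f_mu by the trapezoid inequality, and no
    smaller bound is possible because of the growth in mu at t = 1. *)
Lemma M_infty_eq (u : R) : 0 <= u -> M_infty_u u = Finite ((1 + u) ^ 2).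
Proof.
  intros Hu. assert (HA : 0 < (1 + u) ^ 2) by nra.
  apply Rbar_is_lub_unique. split.
  - intros y [mu [Hmu ->]]. apply Lub_Rbar_correct. intros y [t [Ht ->]]. simpl.
    assert (Ht2 := pow2_ge_0 t).
    apply f_mu_le_iff; [assumption .. | simpl in *; nra |].
    now apply power_sum_ge.
  - intros b Hb.
    assert (Hbf : forall mu t, 0 < mu -> 0 <= t -> Rbar_le (f_mu mu u t) b).
    { intros mu t Hmu Ht. apply Rbar_le_trans with (M_mu mu u).
      - apply Lub_Rbar_correct. now exists t.
      - apply Hb. now exists mu. }
    destruct b as [r | |]; [| exact I | destruct (Hbf 1 0 Rlt_0_1 (Rle_refl 0))].
    simpl.
    assert (Hr : 0 < r).
    { destruct (f_mu_correct 1 0 u Hu Rlt_0_1) as [Hf _].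
      assert (Hf1 := Hbf 1 0 Rlt_0_1 (Rle_refl 0)). simpl in Hf, Hf1. lra. }
    apply (ge_sqr_of_power_sum_ge r u 1); [lra | assumption | lra |].
    intros k. assert (Hk := pos_INR k).
    assert (E := Hbf (1 + INR k) 1 ltac:(lra) Rle_0_1). simpl Rbar_le in E.
    apply f_mu_le_iff in E; [| assumption | lra | simpl; lra].
    now rewrite pow1 in E.
Qed.

Lemma phi_rate_inf (u : R) : 0 <= u ->
  Glb_Rbar (fun y => exists x, 0 < x /\ y = ln (phi u x) / x)
  = Finite (- (1 + u) ^ 2).
Proof.
  intros Hu. apply is_glb_Rbar_unique. split.
  - intros y [x [Hx ->]]. simpl. apply exp_le_phi_iff; [assumption .. |].
    now apply phi_ge.
  - intros b Hb.
    destruct b as [r | |]; [| | exact I].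
    + apply le_opp_sqr_of_phi_ge; [assumption |]. intros x Hx.
      apply exp_le_phi_iff; [assumption .. |].
      apply (Hb (ln (phi u x) / x)). now exists x.
    + apply (Hb (ln (phi u 1) / 1)). exists 1. split; [lra | reflexivity].
Qed.

Theorem theorem2p9 :
  forall u : R, 0 <= u ->
  (forall p : R, 0 <= p ->
    (* (1) *)
    (((forall mu : R, 0 < mu -> completely_monotonic (psi p u mu)) <->
      (exists mu : R, 0 < mu /\ completely_monotonic (psi p u mu))) /\
     ((exists mu : R, 0 < mu /\ completely_monotonic (psi p u mu)) <->
      (0 <= p /\ Rbar_le p (m_infty_u u)))) /\
    (* (2) *)
    (((forall mu : R, 0 < mu ->
         completely_monotonic (fun t : R => - psi p u mu t)) <->
      (exists mu : R, 0 < mu /\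
         completely_monotonic (fun t : R => - psi p u mu t))) /\
     ((exists mu : R, 0 < mu /\
         completely_monotonic (fun t : R => - psi p u mu t)) <->
      Rbar_le (M_infty_u u) p))) /\
  (* (3) *)
  (m_infty_u u =
     Rbar_opp (Lub_Rbar (fun y : R =>
       exists x : R, 0 < x /\ y = ln (phi u x) / x)) /\
   M_infty_u u =
     Rbar_opp (Glb_Rbar (fun y : R =>
       exists x : R, 0 < x /\ y = ln (phi u x) / x))) /\
  (* (4) *)
  (Rbar_lt (u ^ 2 + u) (m_infty_u u) /\
   Rbar_le (m_infty_u u) (u ^ 2 + u + 1 / 6) /\
   M_infty_u u = Finite ((1 + u) ^ 2)).
Proof.
  intros u Hu.
  destruct (phi_rate_sup u Hu) as [P [HL [HP HqP]]].
  assert (Hq : 0 <= u ^ 2 + u) by nra.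
  assert (Hm := m_infty_eq u P Hu ltac:(lra) HP).
  assert (HM := M_infty_eq u Hu).
  rewrite HL, (phi_rate_inf u Hu), Hm, HM.
  split; [| split; [| split; [exact HqP | split; [| reflexivity]]]].
  - intros p Hp.
    assert (up : (exists mu, 0 < mu /\ completely_monotonic (psi p u mu)) -> p <= P).
    { intros [mu [Hmu H]]. apply HP.
      apply (phi_le_of_psi_nonneg p u mu); [assumption .. |].
      now apply completely_monotonic_psi. }
    assert (down : p <= P -> forall mu, 0 < mu -> completely_monotonic (psi p u mu)).
    { intros H mu Hmu. apply completely_monotonic_psi; [assumption .. |].
      intros k t Ht. assert (Hk := pos_INR k).
      apply psi_nonneg_of_phi_le; [assumption .. | now apply HP | lra | assumption]. }
    assert (up' : (exists mu, 0 < mu /\ completely_monotonic (fun t => - psi p u mu t))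
                  -> (1 + u) ^ 2 <= p).
    { intros [mu [Hmu H]].
      apply (ge_sqr_of_power_sum_ge p u mu); [assumption .. |]. intros k.
      assert (E := proj1 (completely_monotonic_opp_psi p u mu Hp Hu Hmu) H k 1 Rlt_0_1).
      rewrite psi_power_sum in E by lra. lra. }
    assert (down' : (1 + u) ^ 2 <= p ->
      forall mu, 0 < mu -> completely_monotonic (fun t => - psi p u mu t)).
    { intros H mu Hmu. apply completely_monotonic_opp_psi; [assumption .. |].
      intros k t Ht. assert (Hk := pos_INR k). rewrite psi_power_sum by assumption.
      assert (E := power_sum_ge (mu + INR k) t u Hu ltac:(lra) ltac:(lra)).
      assert (E2 : / (mu + INR k) * / Rpower (p + t) (mu + INR k)
                <= / (mu + INR k) * / Rpower ((1 + u) ^ 2 + t) (mu + INR k))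
        by (apply inv_Rpower_le_iff; nra).
      lra. }
    assert (H1 := Rlt_0_1).
    split; (split; split).
    + intros H. exists 1. auto.
    + auto.
    + intros H. split; [assumption |]. now apply up.
    + intros [_ H]. exists 1. split; [lra |]. apply down; [exact H | lra].
    + intros H. exists 1. auto.
    + auto.
    + exact up'.
    + intros H. exists 1. split; [lra |]. apply down'; [exact H | lra].
  - simpl. split; f_equal; ring.
  - apply le_q_plus_sixth; [lra | assumption |].
    intros T HT.
    assert (E := power_sum_le_of_phi_le P u 1 T Hu Rlt_0_1 ltac:(lra) ltac:(lra)
      (proj2 (HP P) (Rle_refl P))).
    rewrite Rpower_1, Rinv_1, Rmult_1_l in E by lra. exact E.
Qed.
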